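(* Let $P$ be a UMEL-shellable poset of rank $r$, let $S\subseteq\{1,\dots,r-1\}$ and let $P_S$ be the corresponding rank-selected subposet of $P$. Then: (i) the Chow polynomials $\underline{\mathrm H}_{P_S}(x)$ and $\underline{\mathrm H}_{P_S^*}(x)$ have nonpositive real roots; (ii) the augmented Chow polynomial $\mathrm H_{P_S}(x)$ has nonpositive real roots; (iii) the roots of the polynomials $\underline{\mathrm H}_{P_S}(x)$ and $\mathrm H_{P_S}(x)$ interlace; (iv) the $h$-polynomial of the order complex $\Delta(P_S)$ has nonpositive real roots.
   Context: All posets are finite, bounded (minimum $\hat 0$, maximum $\hat 1$) and graded with rank function $\mathrm{rk}$, $\mathrm{rk}(\hat 0)=0$; the rank of $P$ is $\mathrm{rk}(\hat 1)$. Write $s\lessdot t$ if $t$ covers $s$, and $\mathcal E(P)$ for the set of covering pairs. $P^*$ denotes the dual (order-reversed) poset. For $P$ of rank $r$ and $S\subseteq\{1,\dots,r-1\}$, the rank-selected subposet is the induced subposet $P_S=\{s\in P:\mathrm{rk}(s)\in S\cup\{0,r\}\}$, which is again finite, bounded and graded. UMEL-shellability. An edge labeling is a map $\lambda:\mathcal E(P)\to\Lambda$ to a totally ordered set $(\Lambda,\vartriangleleft)$. It is an EL-labeling if for all $s\le t$ there is a unique maximal chain $s=u_0\lessdot\cdots\lessdot u_k=t$ of $[s,t]$ with weakly increasing labels $\lambda(u_0,u_1)\trianglelefteq\cdots\trianglelefteq\lambda(u_{k-1},u_k)$, and its label sequence is lexicographically minimal among all maximal chains of $[s,t]$. An EL-labeled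 poset is a pair $(P,\lambda)$ with $\lambda$ an EL-labeling of $P$. For $s\in P$ let $\lambda_1\vartriangleleft\cdots\vartriangleleft\lambda_\ell$ be the distinct labels $\lambda(s,t)$, $t\gtrdot s$ (the labels above $s$). The width is $\omega_s(i)=|\{t: s\lessdot t,\ \lambda(s,t)=\lambda_i\}|$ (equal to $0$ for $i>\ell$). For $s\lessdot t$, $\mathrm{Ind}(s,t)$ is the $i$ with $\lambda(s,t)=\lambda_i$, and $\mathrm{des}_s(t)$ is the number of distinct labels above $t$ that are $\vartriangleleft\lambda(s,t)$. $(P,\lambda)$ is a rank-uniform labeled poset if (1) $\omega_s(i)=\omega_{s'}(i)$ for all $s,s'$ of the same rank and all $i\ge1$; and (2) $\mathrm{des}_s(t)=\mathrm{des}_{s'}(t')$ whenever $s\lessdot t$, $s'\lessdot t'$, $\mathrm{rk}(s)=\mathrm{rk}(s')$ and $\mathrm{Ind}(s,t)=\mathrm{Ind}(s',t')$. In that case $\mathrm{des}_k(i)$ denotes $\mathrm{des}_s(t)$ for any $s$ of rank $k$ and $t\gtrdot s$ with $\mathrm{Ind}(s,t)=i$, and $\ell_k$ is the number of distinct labels above any element of rank $k$. It is monotonic if for every $0\le k\le \mathrm{rk}(P)-1$ the function $i\mapsto\mathrm{des}_k(i)$ is weakly increasing on $\{1,\dots,\ell_k\}$. $P$ is UMEL-shellable if it admits an EL-labeling $\lambda$ such that $(P,\lambda)$ is a monotonic rank-uniform labeled poset. Chow polynomials. For $s<t$ let $\chi_{s,t}(x)=\sum_{w\in[s,t]}\mu(s,w)x^{\mathrm{rk}(t)-\mathrm{rk}(w)}$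 ($\mu$ the Möbius function) and $\overline\chi_{s,t}(x)=\chi_{s,t}(x)/(x-1)$. The Chow polynomial is defined recursively by $\underline{\mathrm H}_P(x)=1$ if $|P|=1$ and $\underline{\mathrm H}_P(x)=\sum_{s\in P\setminus\{\hat 0\}}\overline\chi_{\hat 0,s}(x)\,\underline{\mathrm H}_{[s,\hat 1]}(x)$ otherwise. The augmented Chow polynomial is $\mathrm H_P(x)=\sum_{s\in P}x^{\mathrm{rk}(s)}\,\underline{\mathrm H}_{[s,\hat 1]}(x)$. (For $P_S$ and $P_S^*$ these use the rank functions of those posets.) $h$-polynomial. The order complex $\Delta(P)$ is the simplicial complex of all chains of $P$ (omitting $\hat 0,\hat 1$ does not change the $h$-polynomial). For a simplicial complex $\Delta$ of dimension $d-1$ with $f_i$ faces of cardinality $i$, $h(\Delta;y)=\sum_{i=0}^d f_i\,y^i(1-y)^{d-i}$. Interlacing. For real-rooted $f$ of degree $n$ with roots $\alpha_n\le\cdots\le\alpha_1$ and real-rooted $g$ of degree $n$ or $n+1$ with roots $(\beta_{n+1}\le)\,\beta_n\le\cdots\le\beta_1$ (positive leading coefficients), write $f\preceq g$ if $(\beta_{n+1}\le)\,\alpha_n\le\beta_n\le\alpha_{n-1}\le\cdots\le\alpha_1\le\beta_1$. The roots of $f$ and $g$ interlace if $f\preceq g$ or $g\preceq f$; by convention the zeros of any two polynomials of degree $0$ or $1$ interlace. *)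

(* Defs.v *)
From HB Require Import structures.
From mathcomp Require Import all_boot all_order all_algebra.
From mathcomp Require Import complex reals.

Set Implicit Arguments.
Unset Strict Implicit.
Unset Printing Implicit Defensive.

Import Order.TTheory GRing.Theory Num.Theory.
Local Open Scope order_scope.

Section Graded.
Context {d : Order.disp_t} {T : finTBPOrderType d}.
Implicit Types s t w : T.

Definition covers s t : bool :=
  (s < t) && [forall w, ~~ ((s < w) && (w < t))].

Definition is_chain (A : {set T}) : bool :=
  [forall x in A, forall y in A, x >=< y].

(* The length of a longest chain of [\bot, s].  On a graded poset this is the
   rank function, see [rank_functionE]. *)
Definition rank s : nat :=
  (\max_(A : {set T} | is_chain A && [forall x in A, (x <= s)%O]) #|A|).-1.

Definition is_rank_function (rk : T -> nat) : Prop :=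
  rk \bot = 0%N /\ (forall s t, covers s t -> rk t = (rk s).+1).

Definition graded : Prop := exists rk : T -> nat, is_rank_function rk.

End Graded.

Arguments graded {d} T.

Section GradedTheory.
Context {d : Order.disp_t} {T : finTBPOrderType d}.
Implicit Types s t w : T.

Lemma is_chainP (A : {set T}) :
  reflect {in A &, forall x y, x >=< y} (is_chain A).
Proof.
apply: (iffP forall_inP) => [h x y xA yA|h x xA].
  by move/forall_inP: (h x xA); apply.
by apply/forall_inP => y yA; apply: h.
Qed.

Lemma rank0 : rank (\bot : T) = 0%N.
Proof.
apply/eqP; rewrite /rank -subn1 subn_eq0; apply/bigmax_leqP => A.
case/andP=> _ /forall_inP hA; rewrite -(cards1 (\bot : T)).
apply/subset_leq_card/subsetP => x /hA.
by rewrite lex0 inE.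
Qed.

Lemma covers_lt s t : covers s t -> s < t. Proof. by case/andP. Qed.

Lemma leq_rank (A : {set T}) s :
  is_chain A -> {in A, forall x, x <= s} -> (#|A| <= (rank s).+1)%N.
Proof.
move=> cA hA; rewrite /rank; set m := \max_(_ | _) _.
suff : (#|A| <= m)%N by move/leq_trans; apply; exact: leqSpred.
apply: (@leq_bigmax_cond _ _ (fun A : {set T} => #|A|)).
by rewrite cA /=; apply/forall_inP.
Qed.

Lemma rankP s :
  exists A : {set T}, [/\ is_chain A, {in A, forall x, x <= s} & #|A| = (rank s).+1].
Proof.
have P0 : is_chain [set s] && [forall x in [set s], (x <= s)%O].
  apply/andP; split; last by apply/forall_inP => x; rewrite inE => /eqP ->.
  by apply/is_chainP => x y; rewrite !inE => /eqP -> /eqP ->; exact: comparablexx.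
case: (@arg_maxnP _ [set s] (fun A : {set T} =>
  is_chain A && [forall x in A, (x <= s)%O]) (fun A => #|A|) P0).
move=> A /andP[cA /forall_inP hA] maxA; exists A; split=> //.
have A1 : (0 < #|A|)%N by apply: leq_trans (maxA _ P0); rewrite /= cards1.
apply/eqP; rewrite eqn_leq leq_rank //= /rank -[leqRHS](prednK A1) ltnS.
rewrite -!subn1 leq_sub2r //; apply/bigmax_leqP => B hB; exact: maxA.
Qed.

Lemma rank_lt s t : s < t -> (rank s < rank t)%N.
Proof.
move=> st; have [A [cA hA eA]] := rankP s.
have tA : t \notin A by apply/negP => /hA ts; rewrite (le_gtF ts) in st.
rewrite -ltnS -eA -add1n; have := cardsU1 t A; rewrite tA => <-.
have leAt x : x \in A -> x <= t by move/hA => xs; exact/ltW/(le_lt_trans xs).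
apply: leq_rank => [|x]; last by rewrite !inE => /predU1P[->//|/leAt].
apply/is_chainP => x y; rewrite !inE.
case/predU1P => [->|xA]; case/predU1P => [->|yA].
- exact: comparablexx.
- by rewrite comparable_sym; exact/le_comparable/leAt.
- exact/le_comparable/leAt.
- by move/is_chainP: cA; apply.
Qed.

Lemma exists_coatom s : s != \bot -> exists w, covers w s.
Proof.
rewrite -lt0x => s0.
case: (@arg_maxnP _ (\bot : T) (fun w => w < s) rank s0) => w ws wmax.
exists w; rewrite /covers ws /=; apply/forallP => u; apply/negP => /andP[wu us].
by have := wmax u us; rewrite /= leqNgt rank_lt.
Qed.

Lemma rank_functionE (rk : T -> nat) : is_rank_function rk -> rk =1 rank.
Proof.
case=> rk0 rkS.
have lt_rk s t : s < t -> (rk s < rk t)%N.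
  have [n] := ubnP (rank t); elim: n t => // n IH t tn st.
  have [w wt] : exists w, covers w t /\ s <= w.
    case: (@arg_maxnP _ s (fun w => (s <= w) && (w < t)) rank).
      by rewrite lexx.
    move=> w /andP[sw wt] wmax; exists w; split=> //; rewrite /covers wt /=.
    apply/forallP => u; apply/negP => /andP[wu ut].
    have := wmax u; rewrite ut (le_trans sw (ltW wu)) => /(_ isT).
    by rewrite /= leqNgt rank_lt.
  case: wt => wt; rewrite le_eqVlt => /predU1P[->|sw]; first by rewrite (rkS _ _ wt).
  rewrite (rkS _ _ wt) ltnS ltnW // IH //.
  by apply: leq_trans (rank_lt (covers_lt wt)) _; rewrite -ltnS.
move=> s; apply/eqP; rewrite eqn_leq; apply/andP; split.
  have [n] := ubnP (rank s); elim: n s => // n IH s sn.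
  have [->|/exists_coatom[w ws]] := eqVneq s \bot; first by rewrite rk0.
  rewrite (rkS _ _ ws); apply: leq_trans (rank_lt (covers_lt ws)).
  by rewrite ltnS IH //; apply: leq_trans (rank_lt (covers_lt ws)) _.
rewrite /rank; set m := \max_(_ | _) _.
suff : (m <= (rk s).+1)%N by case: m.
apply/bigmax_leqP => A /andP[/is_chainP cA /forall_inP hA].
have rk_s x : x \in A -> (rk x < (rk s).+1)%N.
  by move=> /hA; rewrite le_eqVlt => /predU1P[->//|/lt_rk/ltnW].
rewrite -(card_ord (rk s).+1) -(@card_in_imset _ _ (fun x => inord (rk x) : 'I_(rk s).+1)).
  exact: max_card.
move=> x y xA yA /(congr1 val); rewrite /= !inordK ?rk_s // => exy.
apply/eqP; case: (comparable_ltgtP (cA _ _ xA yA)) => // /lt_rk;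
  by rewrite exy ltnn.
Qed.

End GradedTheory.

Section Mobius.
Context {d : Order.disp_t} {T : finTBPOrderType d}.
Implicit Types s t w : T.
Local Open Scope ring_scope.

(* The first argument is fuel; [#|T|] is enough, see [mobiusE]. *)
Fixpoint mobius_rec (n : nat) s t : int :=
  if n is n'.+1 then
    if s == t then 1
    else if (s < t)%O then - \sum_(w : T | (s <= w)%O && (w < t)%O) mobius_rec n' s w
    else 0
  else 0.

Definition mobius s t : int := mobius_rec #|T| s t.

Lemma card_below_lt (w t : T) : (w < t)%O ->
  (#|[set u | (u < w)%O]| < #|[set u | (u < t)%O]|)%N.
Proof.
move=> wt; apply: proper_card; apply/properP; split.
  by apply/subsetP => u; rewrite !inE => /lt_trans; apply.
by exists w; rewrite inE // ltxx.
Qed.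

Lemma mobius_rec_stable m n s t :
  (#|[set u | (u < t)%O]| < m)%N -> (#|[set u | (u < t)%O]| < n)%N ->
  mobius_rec m s t = mobius_rec n s t.
Proof.
elim: m n t => [//|m IH] [//|n] t hm hn /=.
case: eqP => // _; case: ifP => // st; congr (- _).
apply: eq_bigr => w /andP[_ wt]; apply: IH.
  exact: leq_trans (card_below_lt wt) hm.
exact: leq_trans (card_below_lt wt) hn.
Qed.

Lemma mobiusE s t :
  mobius s t = if s == t then 1
               else if (s < t)%O then
                 - \sum_(w : T | (s <= w)%O && (w < t)%O) mobius s w
               else 0.
Proof.
have bt w : (#|[set u : T | (u < w)%O]| < #|T|)%N.
  rewrite -[ltnRHS]cardsT; apply: proper_card; apply/properP; split=> //.
  by exists w; rewrite ?inE ?ltxx.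
rewrite {1}/mobius (@mobius_rec_stable _ #|T|.+1 s t) //=; exact: leqW.
Qed.

Lemma mobius_sum0 s t :
  (s < t)%O -> \sum_(w : T | (s <= w)%O && (w <= t)%O) mobius s w = 0.
Proof.
move=> st; rewrite (bigD1 t) /= ?(ltW st) ?lexx // mobiusE lt_eqF // st.
rewrite addrC; apply/eqP; rewrite subr_eq0; apply/eqP/eq_bigl => w.
by rewrite -andbA [(w <= t)%O && _]andbC -lt_neqAle.
Qed.

End Mobius.

Section ChowPolynomial.
Context (R : realType) {d : Order.disp_t} {T : finTBPOrderType d}.
Implicit Types s t w : T.
Local Open Scope ring_scope.

Definition charpoly s t : {poly R} :=
  \sum_(w : T | (s <= w)%O && (w <= t)%O)
     (mobius s w)%:~R *: 'X^(rank t - rank w).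

(* The division is exact, see [red_charpolyM]. *)
Definition red_charpoly s t : {poly R} := charpoly s t %/ ('X - 1).

Lemma red_charpolyM s t :
  (s < t)%O -> red_charpoly s t * ('X - 1) = charpoly s t.
Proof.
move=> st; apply: divpK; rewrite -polyC1 dvdp_XsubCl rootE /charpoly.
rewrite horner_sum; under eq_bigr do rewrite hornerZ hornerXn expr1n mulr1.
by rewrite -rmorph_sum /= mobius_sum0 // rmorph0.
Qed.

(* [chow_above s] is the Chow polynomial of the interval [s, \top], whose
   characteristic polynomials are those of [T] since they only involve rank
   differences.  The first argument of [chow_above_rec] is fuel; [#|T|] is
   enough, see [chow_aboveE]. *)
Fixpoint chow_above_rec (n : nat) s : {poly R} :=
  if n is n'.+1 then
    if s == \top%O then 1
    else \sum_(w : T | (s < w)%O) red_charpoly s w * chow_above_rec n' w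
  else 0.

Definition chow_above s : {poly R} := chow_above_rec #|T| s.

Lemma card_above_lt (s w : T) : (s < w)%O ->
  (#|[set u | (w < u)%O]| < #|[set u | (s < u)%O]|)%N.
Proof.
move=> sw; apply: proper_card; apply/properP; split.
  by apply/subsetP => u; rewrite !inE; apply: lt_trans.
by exists w; rewrite inE // ltxx.
Qed.

Lemma chow_above_rec_stable m n s :
  (#|[set u | (s < u)%O]| < m)%N -> (#|[set u | (s < u)%O]| < n)%N ->
  chow_above_rec m s = chow_above_rec n s.
Proof.
elim: m n s => [//|m IH] [//|n] s hm hn /=.
case: eqP => // _; apply: eq_bigr => w sw; congr (_ * _); apply: IH.
  exact: leq_trans (card_above_lt sw) hm.
exact: leq_trans (card_above_lt sw) hn.
Qed.

Lemma chow_aboveE s :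
  chow_above s = if s == \top%O then 1
                 else \sum_(w : T | (s < w)%O) red_charpoly s w * chow_above w.
Proof.
have bt w : (#|[set u : T | (w < u)%O]| < #|T|)%N.
  rewrite -[ltnRHS]cardsT; apply: proper_card; apply/properP; split=> //.
  by exists w; rewrite ?inE ?ltxx.
rewrite {1}/chow_above (@chow_above_rec_stable _ #|T|.+1 s) //=; exact: leqW.
Qed.

End ChowPolynomial.

Definition chow (R : realType) {d : Order.disp_t} (T : finTBPOrderType d) :
  {poly R} := chow_above R (\bot : T).

Definition aug_chow (R : realType) {d : Order.disp_t} (T : finTBPOrderType d) :
  {poly R} := (\sum_(s : T) 'X^(rank s) * chow_above R s)%R.

Section RankSelection.
Context {d : Order.disp_t} (T : finTBPOrderType d) (S : pred nat).

Definition in_rank_sel (s : T) : bool :=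
  [|| rank s \in S, rank s == 0%N | rank s == rank (\top : T)].

Definition rank_sel : Type := {s : T | in_rank_sel s}.

HB.instance Definition _ := Finite.on rank_sel.
HB.instance Definition _ := SubFinite.on rank_sel.
HB.instance Definition _ :=
  [SubChoice_isSubPOrder of rank_sel by <: with d].

Lemma rank_sel_bot_subproof : in_rank_sel \bot.
Proof. by rewrite /in_rank_sel rank0 eqxx orbT. Qed.
Lemma rank_sel_top_subproof : in_rank_sel \top.
Proof. by rewrite /in_rank_sel eqxx !orbT. Qed.

Lemma rank_sel_le0x (x : rank_sel) :
  (exist _ \bot rank_sel_bot_subproof : rank_sel) <= x.
Proof. by rewrite -Order.le_val /= le0x. Qed.
Lemma rank_sel_lex1 (x : rank_sel) :
  x <= (exist _ \top rank_sel_top_subproof : rank_sel).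
Proof. by rewrite -Order.le_val /= lex1. Qed.

HB.instance Definition _ := Order.hasBottom.Build d rank_sel rank_sel_le0x.
HB.instance Definition _ := Order.hasTop.Build d rank_sel rank_sel_lex1.

End RankSelection.

Section EdgeLabelings.
Context {d : Order.disp_t} {T : finTBPOrderType d}.
Context {dL : Order.disp_t} {L : orderType dL}.
(* Only the values of [lam] on covering pairs are ever used. *)
Variable lam : T -> T -> L.
Implicit Types s t : T.

Definition max_chain s t (c : seq T) : bool :=
  path covers s c && (last s c == t).

Definition labels s (c : seq T) : seq L := pairmap lam s c.

Definition EL_labeling : Prop :=
  forall s t, s <= t -> exists c,
    [/\ max_chain s t c,
        sorted <=%O (labels s c),
        forall c', max_chain s t c' -> sorted <=%O (labels s c') -> c' = c &
        forall c', max_chain s t c' ->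
          (labels s c : seqlexi L) <= labels s c'].

Definition labels_above s : seq L :=
  sort <=%O (undup [seq lam s t | t <- enum T & covers s t]).

(* Indices of labels start at 1. *)
Definition Ind s t : nat := (index (lam s t) (labels_above s)).+1.

Definition width s (i : nat) : nat :=
  #|[set t | covers s t && (Ind s t == i)]|.

Definition des s t : nat :=
  size [seq a <- labels_above t | a < lam s t].

Definition rank_uniform : Prop :=
  (forall s s' i, rank s = rank s' -> (1 <= i)%N -> width s i = width s' i) /\
  (forall s t s' t', covers s t -> covers s' t' -> rank s = rank s' ->
     Ind s t = Ind s' t' -> des s t = des s' t').

(* [des_k(i) <= des_k(j)] for [i <= j], where [des_k(i)] is [des s t] for any
   [s] of rank [k] and [t] covering [s] with [Ind s t = i]. *)
Definition monotonic : Prop :=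
  forall s t s' t', covers s t -> covers s' t' -> rank s = rank s' ->
    (Ind s t <= Ind s' t')%N -> (des s t <= des s' t')%N.

End EdgeLabelings.

Definition UMEL_shellable {d : Order.disp_t} (T : finTBPOrderType d) : Prop :=
  exists (dL : Order.disp_t) (L : orderType dL) (lam : T -> T -> L),
    [/\ EL_labeling lam, rank_uniform lam & monotonic lam].

Definition order_complex {d : Order.disp_t} (T : finTBPOrderType d) :
  {set {set T}} := [set A | is_chain A].

Section RealPolynomials.
Context (R : realType).
Local Open Scope ring_scope.
Implicit Types f g : {poly R}.

Definition f_number {V : finType} (D : {set {set V}}) (i : nat) : nat :=
  #|[set A in D | #|A| == i]|.

Definition h_polynomial {V : finType} (D : {set {set V}}) : {poly R} :=
  let n := (\max_(A in D) #|A|)%N in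
  \sum_(i < n.+1) (f_number D i)%:R *: ('X^i * (1 - 'X) ^+ (n - i)).

Definition nonpos_real_roots f : Prop :=
  forall z : R[i], root (map_poly (real_complex R) f) z ->
    exists2 a : R, z = real_complex R a & a <= 0.

(* [f] is real-rooted, [s] lists its roots with multiplicity, largest first. *)
Definition roots_of f (s : seq R) : Prop :=
  [/\ f != 0, f = lead_coef f *: \prod_(a <- s) ('X - a%:P) & sorted >=%R s].

(* [alpha_(i+1)] and [beta_(i+1)] are [a`_i] and [b`_i]. *)
Definition interlaces f g : Prop :=
  [/\ 0 < lead_coef f, 0 < lead_coef g &
      exists a b : seq R,
        [/\ roots_of f a /\ roots_of g b,
            size b = size a \/ size b = (size a).+1,
            forall i, (i < size a)%N -> a`_i <= b`_i &
            forall i, (i.+1 < size b)%N -> b`_i.+1 <= a`_i]].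

Definition roots_interlace f g : Prop :=
  [\/ interlaces f g, interlaces g f |
      (1 <= size f <= 2)%N && (1 <= size g <= 2)%N].

End RealPolynomials.

(* Main.v *)
Require Import Defs.
From mathcomp Require Import all_boot all_order all_algebra.
From mathcomp Require Import complex reals.
From mathcomp Require Import ring zify.

(** Fix a complex number [x] outside the half-line (-oo, 0].  Each polynomial
    is shown not to vanish at [x]: its value there is a sum of numbers which,
    up to a common rotation, lie in one cone without lines.

    _Transfer._  An edge of [P] from rank k to rank k + 1 is recorded by its
    state, the index of its label among the labels above its lower end.  The
    number [om k i] of edges in state i above an element depends only on its
    rank k, and an edge in state j following an edge in state i is an ascent
    exactly when [ds k i <= j], where [ds k] is weakly increasing.  Since
    intervals have unique weakly increasing chains, the number of elements of
    rank m above an element of rank k counts walks of ascents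
    ([card_rank_above]).

    _Chow polynomials._  They satisfy
    H(s) = 1 + sum over w > s of (x + ... + x^(rho(s,w) - 1)) H(w)
    ([chow_above_qsum]), so they depend only on these numbers, and selecting
    ranks merely restricts the sum.  The recursion is solved by
    carrying down the ranks a pair (a, b) of vectors indexed by states
    ([chow_run]).  Let A and D be the operators summing over the next ascents
    and over the next descents.  At a selected rank (a, b) becomes
    (A b, (1 + x) A b + x D a); at another rank it becomes (A a, A b).  The
    Chow polynomial is the total of a and the augmented one the total of b
    ([ev_chow_bot], [ev_aug_chow]).  This is the gamma expansion in transfer
    form: up to powers of 1 + x, each descent has weight z = x / (1 + x)^2,
    no two consecutive selected ranks are descents, and the first selected
    rank is never a descent in a.  For the dual poset the last selected rank
    is excluded instead, which amounts to another initial pair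
    ([ev_chow_dual]).

    _Nonvanishing._  Write f << g when g times the conjugate of f lies in the
    cone spanned by 1 and z, that is, when arg(g/f) is in [0, arg z].  This
    is the value at a point of the usual interlacing relation; it is
    biadditive, and f << g implies g << z f.  Hence preservation of a suitable
    family of such relations by the transfer ([compatible_select],
    [compatible_skip]) is linear algebra and uses only that [ds k] is weakly
    increasing; and a sum of numbers of which each is << the later ones
    vanishes only if all of them do ([between_sum_neq0]).  As z lies in
    (-oo, 0] only if x does ([koebe_slit]), all Chow polynomials are nonzero at
    [x].  The h-polynomial is treated alike, with weight x on every descent at
    a selected rank ([ev_h_polynomial]).

    _Interlacing._  Let F and G be the Chow and the augmented Chow polynomial.
    The relation between a and b says that Im (G(x) conj F(x)) >= 0 when
    Im x > 0 ([run_between]).  Near a real point c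
    this forces the multiplicities of c in F and G to differ as they do for
    interlacing polynomials, given the parity of the number of roots above c
    ([local_multiplicity]); letting c decrease from +oo gives the interlacing
    of the roots ([above_interlace]). *)

Set Implicit Arguments.
Unset Strict Implicit.
Unset Printing Implicit Defensive.

Import Order.TTheory GRing.Theory Num.Theory.
Local Open Scope ring_scope.

(** * Cones in the complex plane *)

Section Cone.
Context {C : numClosedFieldType}.
Implicit Types (z w f g : C).

Definition in_cone z w : Prop :=
  exists s t : C, [/\ 0 <= s, 0 <= t & w = s + t * z].

(** For real nonnegative [s] and [t]: the cone spanned by 1 and [z] contains no
    line and [z] is nonzero. *)
Definition salient z : Prop :=
  forall s t : C, 0 <= s -> 0 <= t -> s + t * z = 0 -> s = 0 /\ t = 0.

(** For [f] nonzero this says that arg(g/f) lies between 0 and arg z.  Being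
    additive in [f] and in [g] separately, it passes to nonnegative
    combinations on either side ([between_sum]). *)
Definition between z f g : Prop := in_cone z (g * f^*).

Lemma in_coneD z w w' : in_cone z w -> in_cone z w' -> in_cone z (w + w').
Proof.
move=> [s [t [s0 t0 ->]]] [s' [t' [s0' t0' ->]]].
by exists (s + s'), (t + t'); rewrite !addr_ge0 //; split=> //; ring.
Qed.

Lemma in_coneZ z c w : 0 <= c -> in_cone z w -> in_cone z (c * w).
Proof.
move=> c0 [s [t [s0 t0 ->]]]; exists (c * s), (c * t).
by rewrite !mulr_ge0 //; split=> //; ring.
Qed.

Lemma ge0_in_cone z c : 0 <= c -> in_cone z c.
Proof. by move=> c0; exists c, 0; rewrite mul0r addr0. Qed.

Lemma in_cone_sum z (I : Type) (r : seq I) (Q : pred I) (F : I -> C) :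
  (forall i, Q i -> in_cone z (F i)) -> in_cone z (\sum_(i <- r | Q i) F i).
Proof.
move=> h; elim/big_ind: _ => //; first exact: ge0_in_cone.
exact: in_coneD.
Qed.

Lemma in_cone_add_eq0 z w w' : salient z -> in_cone z w -> in_cone z w' ->
  w + w' = 0 -> w = 0 /\ w' = 0.
Proof.
move=> zP [s [t [s0 t0 ->]]] [s' [t' [s0' t0' ->]]] e.
have [] := zP (s + s') (t + t'); rewrite ?addr_ge0 //; first by rewrite -e; ring.
move/eqP; rewrite paddr_eq0 // => /andP[/eqP -> /eqP ->].
move/eqP; rewrite paddr_eq0 // => /andP[/eqP -> /eqP ->].
by rewrite mul0r addr0.
Qed.

Lemma between_refl z f : between z f f.
Proof. exact/ge0_in_cone/mul_conjC_ge0. Qed.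

Lemma betweenDl z f f' g : between z f g -> between z f' g -> between z (f + f') g.
Proof. by move=> h h'; rewrite /between rmorphD mulrDr; exact: in_coneD. Qed.

Lemma betweenDr z f g g' : between z f g -> between z f g' -> between z f (g + g').
Proof. by move=> h h'; rewrite /between mulrDl; exact: in_coneD. Qed.

Lemma between0l z g : between z 0 g.
Proof. by rewrite /between rmorph0 mulr0; exact: ge0_in_cone. Qed.

(** Passing from arg(g/f) to arg(zf/g) = arg z - arg(g/f) reverses the arc from
    0 to arg z. *)
Lemma between_rot z f g : between z f g -> between z g (z * f).
Proof.
move=> [s [t [s0 t0 e]]]; exists (t * (z * z^*)), s.
rewrite mulr_ge0 ?mul_conjC_ge0 //; split=> //.
have -> : z * f * g^* = z * (g * f^*)^* by rewrite rmorphM /= conjCK -mulrA (mulrC f).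
rewrite e rmorphD rmorphM /= (conj_Creal (ger0_real s0)) (conj_Creal (ger0_real t0)).
by ring.
Qed.

Lemma between_scale z c f g : between z f g -> between z (c * f) (c * g).
Proof.
move=> h; rewrite /between rmorphM /=.
have -> : c * g * (c^* * f^*) = (c * c^*) * (g * f^*) by ring.
exact/in_coneZ/h/mul_conjC_ge0.
Qed.

Lemma between_sum z (I J : Type) (r : seq I) (r' : seq J) (Q : pred I)
    (Q' : pred J) (u f : I -> C) (v g : J -> C) :
  (forall i, Q i -> 0 <= u i) -> (forall j, Q' j -> 0 <= v j) ->
  (forall i j, Q i -> Q' j -> between z (f i) (g j)) ->
  between z (\sum_(i <- r | Q i) u i * f i) (\sum_(j <- r' | Q' j) v j * g j).
Proof.
move=> u0 v0 fg; rewrite /between mulr_suml; apply: in_cone_sum => j Qj.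
rewrite rmorph_sum mulr_sumr; apply: in_cone_sum => i Qi.
rewrite /= rmorphM /= (conj_Creal (ger0_real (u0 _ Qi))).
have -> : v j * g j * (u i * (f i)^*) = (v j * u i) * (g j * (f i)^*) by ring.
by apply: in_coneZ; [rewrite mulr_ge0 ?u0 ?v0|exact: fg].
Qed.

Lemma between_add_eq0 z f g : salient z -> between z f g -> f + g = 0 -> f = 0 /\ g = 0.
Proof.
move=> zP fg e.
have : f * f^* + g * f^* = 0 by rewrite -mulrDl e mul0r.
case/(in_cone_add_eq0 zP (between_refl z f) fg)=> /eqP.
rewrite mul_conjC_eq0 => /eqP f0 _; split=> //.
by rewrite f0 add0r in e.
Qed.

(** The first nonzero term, times its own conjugate, is positive, and after
    multiplication by that conjugate the later terms lie in the cone.  So the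
    sum can vanish only if each term does. *)
Lemma between_sum_neq0 z n (Q : pred 'I_n) (u f : 'I_n -> C) (j0 : 'I_n) :
  salient z -> (forall j, Q j -> 0 <= u j) ->
  (forall i j, Q i -> Q j -> (i < j)%N -> between z (f i) (f j)) ->
  Q j0 -> u j0 * f j0 != 0 -> \sum_(j | Q j) u j * f j != 0.
Proof.
move=> zP u0 fP Qj0 nz; apply/eqP => e; case/eqP: nz.
have [m] := ubnP (j0 : nat); elim: m j0 Qj0 => // m IH j0 Qj0 jm.
have zero i : Q i -> (i < j0)%N -> u i * f i = 0.
  by move=> Qi ij; apply: IH => //; exact: leq_trans ij jm.
pose g j := u j * f j * (u j0 * f j0)^*.
have : \sum_(j | Q j) g j = 0 by rewrite -mulr_suml e mul0r.
rewrite (bigD1 j0) //= => /(in_cone_add_eq0 zP).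
case; first exact: between_refl.
  apply: in_cone_sum => j /andP[Qj jj0]; rewrite /g.
  case: (ltngtP j j0) => [lt|gt|/val_inj e']; last by rewrite e' eqxx in jj0.
    by rewrite zero // mul0r; exact: ge0_in_cone.
  rewrite rmorphM /= (conj_Creal (ger0_real (u0 _ Qj0))).
  have -> : u j * f j * (u j0 * (f j0)^*) = u j * u j0 * (f j * (f j0)^*) by ring.
  by apply: in_coneZ; [rewrite mulr_ge0 ?u0|exact: fP].
by move/eqP; rewrite mul_conjC_eq0 => /eqP.
Qed.

End Cone.

(** * One step of the transfer *)

Section Steps.
Context {F : comNzRingType}.

Definition wsum (n : nat) (w : nat -> nat) (Q : pred nat) (f : nat -> F) : F :=
  \sum_(j < n | Q j) (w j)%:R * f j.

Lemma eq_wsum n w Q f g : (forall j, (j < n)%N -> f j = g j) ->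
  wsum n w Q f = wsum n w Q g.
Proof. by move=> e; apply: eq_bigr => j _; rewrite e. Qed.

Lemma wsumD n w Q f g :
  wsum n w Q (fun j => f j + g j) = wsum n w Q f + wsum n w Q g.
Proof. by rewrite /wsum -big_split; apply: eq_bigr => j _; rewrite mulrDr. Qed.

Lemma wsumZ n w Q c f : wsum n w Q (fun j => c * f j) = c * wsum n w Q f.
Proof. by rewrite /wsum mulr_sumr; apply: eq_bigr => j _; rewrite mulrCA. Qed.

Lemma wsum_sum n w Q (I : Type) (r : seq I) (P : pred I) f :
  wsum n w Q (fun j => \sum_(i <- r | P i) f i j)
  = \sum_(i <- r | P i) wsum n w Q (f i).
Proof.
rewrite /wsum exchange_big; apply: eq_bigr => j _.
by rewrite mulr_sumr.
Qed.

Lemma wsumID n w Q Q' f :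
  wsum n w Q f = wsum n w (predI Q Q') f + wsum n w (predI Q (predC Q')) f.
Proof. by rewrite /wsum (bigID (fun j : 'I_n => Q' j)). Qed.

Lemma wsum_above n w p q f : (p <= q)%N ->
  wsum n w (fun j => p <= j)%N f =
  wsum n w (fun j => p <= j < q)%N f + wsum n w (fun j => q <= j)%N f.
Proof.
move=> pq; rewrite (@wsumID n w _ (fun j => j < q)%N); congr (_ + _).
by apply: eq_bigl => j /=; lia.
Qed.

Lemma wsum_below n w p q f : (p <= q)%N ->
  wsum n w (fun j => j < q)%N f =
  wsum n w (fun j => j < p)%N f + wsum n w (fun j => p <= j < q)%N f.
Proof.
move=> pq; rewrite (@wsumID n w _ (fun j => j < p)%N); congr (_ + _);
by apply: eq_bigl => j /=; lia.
Qed.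

End Steps.

Section Invariant.
Context {C : numClosedFieldType}.
Variable z : C.
Local Notation "f <~ g" := (between z f g) (at level 70, no associativity).

(** This is the invariant carried by the transfer.  The last clause does not
    follow from the relations [a i] << [b j] for i < j, since in it each [a i]
    also meets the earlier [b j]; it requires the same weights on both sides. *)
Definition compatible (n : nat) (a b : nat -> C) : Prop :=
  [/\ forall i j, (i <= j < n)%N -> b i <~ b j,
      forall i j, (i <= j < n)%N -> a i <~ a j,
      forall i j, (i < j < n)%N -> a i <~ b j &
      forall u : nat -> C, (forall j, 0 <= u j) ->
        \sum_(j < n) u j * a j <~ \sum_(j < n) u j * b j].

Lemma compatible_diag n b :
  (forall i j, (i <= j < n)%N -> b i <~ b j) -> compatible n b b.
Proof.
by move=> h; split=> // [i j /andP[/ltnW ij jn]|u u0];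
  [apply: h; rewrite ij | exact: between_refl].
Qed.

Lemma wsum_between n w (Q Q' : pred nat) f g :
  (forall i j, (i < n)%N -> (j < n)%N -> Q i -> Q' j -> f i <~ g j) ->
  wsum n w Q f <~ wsum n w Q' g.
Proof.
move=> h; apply: between_sum => [i _|j _|i j Qi Qj]; rewrite ?ler0n //.
exact: h.
Qed.

Section OneStep.
Variables (n : nat) (w : nat -> nat) (a b : nat -> C).
Hypothesis ab : compatible n a b.

Local Notation Y p := (wsum n w (fun j => p <= j)%N b).
Local Notation A p := (wsum n w (fun j => p <= j)%N a).
Local Notation W p := (wsum n w (fun j => j < p)%N a).

Lemma compatible_wsum Q : wsum n w Q a <~ wsum n w Q b.
Proof.
have [_ _ _ /(_ (fun j => if Q j then (w j)%:R else 0))] := ab.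
have e (f : nat -> C) : \sum_(j < n) (if Q j then (w j)%:R else 0) * f j = wsum n w Q f.
  rewrite /wsum [RHS]big_mkcond; apply: eq_bigr => j _.
  by case: ifP => // _; rewrite mul0r.
by rewrite !e; apply=> j; case: ifP; rewrite ?ler0n.
Qed.

Lemma above_mono p q : (p <= q)%N -> Y p <~ Y q.
Proof.
have [bb _ _ _] := ab; move=> pq; rewrite (wsum_above _ _ _ pq).
apply: betweenDl; last exact: between_refl.
by apply: wsum_between => i j *; apply: bb; lia.
Qed.

Lemma above_mono_a p q : (p <= q)%N -> A p <~ A q.
Proof.
have [_ aa _ _] := ab; move=> pq; rewrite (wsum_above _ _ _ pq).
apply: betweenDl; last exact: between_refl.
by apply: wsum_between => i j *; apply: aa; lia.
Qed.

Lemma above_ab p q : (p <= q)%N -> A p <~ Y q.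
Proof.
have [_ _ aBb _] := ab; move=> pq; rewrite (wsum_above _ _ _ pq).
apply: betweenDl; last exact: compatible_wsum.
by apply: wsum_between => i j *; apply: aBb; lia.
Qed.

(** Beyond pairs i < j, the two windows overlap in one common window, where the
    last clause of [compatible] applies. *)
Lemma below_above p q : W p <~ Y q.
Proof.
have [bb aa aBb _] := ab.
have [pq|/ltnW qp] := leqP p q.
  by apply: wsum_between => i j *; apply: aBb; lia.
rewrite (wsum_below _ _ _ qp); apply: betweenDl.
  by apply: wsum_between => i j *; apply: aBb; lia.
rewrite (wsum_above _ _ _ qp); apply: betweenDr; first exact: compatible_wsum.
by apply: wsum_between => i j *; apply: aBb; lia.
Qed.

(** The state vector (b, z a) is read cyclically: raising the threshold from p
    to q trades the [b j] with p <= j < q for the [z * a j] with the same j. *)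
Lemma window_mono p q : (p <= q)%N -> Y p + z * W p <~ Y q + z * W q.
Proof.
have [bb aa aBb _] := ab; move=> pq.
rewrite (wsum_above _ _ _ pq) [W q](wsum_below _ _ _ pq) mulrDr.
(* The part of each window that the other one lacks. *)
set X := wsum n w (fun j => p <= j < q)%N b.
set U := wsum n w (fun j => p <= j < q)%N a.
have WX : W p <~ X by apply: wsum_between => i j *; apply: aBb; lia.
have UY : U <~ Y q by apply: wsum_between => i j *; apply: aBb; lia.
have WU : W p <~ U by apply: wsum_between => i j *; apply: aa; lia.
have XY : X <~ Y q by apply: wsum_between => i j *; apply: bb; lia.
have UX : U <~ X by exact: compatible_wsum.
rewrite -addrA [X in _ <~ X]addrA; apply: betweenDl.
  by apply: betweenDr; [apply: betweenDr|]; rewrite //; apply: between_rot.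
apply: betweenDr; first exact: between_refl.
apply: betweenDl; first exact: between_rot.
exact: between_scale.
Qed.

Variables (n' : nat) (d : nat -> nat).
Hypothesis d_mono : forall i j, (i <= j < n')%N -> (d i <= d j)%N.

(** Passing a selected rank: the threshold of state i is [d i], ascents go to
    [b] and descents to [z * a]. *)
Lemma compatible_select :
  compatible n' (fun i => Y (d i)) (fun i => Y (d i) + z * W (d i)).
Proof.
split=> [i j ij|i j ij|i j ij|u u0].
- exact/window_mono/d_mono.
- exact/above_mono/d_mono.
- apply: betweenDr; last exact/between_rot/below_above.
  by apply/above_mono/d_mono; lia.
- under [X in _ <~ X]eq_bigr do rewrite mulrDr.
  rewrite big_split; apply: betweenDr; first exact: between_refl.
  under [X in _ <~ X]eq_bigr do rewrite mulrCA.
  rewrite -mulr_sumr; apply: between_rot.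
  apply: between_sum => // i j _ _; exact: below_above.
Qed.

(** Passing a rank that is not selected, where only ascents are allowed. *)
Lemma compatible_skip : compatible n' (fun i => A (d i)) (fun i => Y (d i)).
Proof.
split=> [i j ij|i j ij|i j ij|u u0].
- exact/above_mono/d_mono.
- exact/above_mono_a/d_mono.
- by apply/above_ab/d_mono; lia.
(* Exchanging the sums gives [a j] and [b j] the same weight. *)
- pose u' j := \sum_(i < n' | (d i <= j)%N) u i * (w j)%:R.
  have e (f : nat -> C) : \sum_(i < n') u i * wsum n w (fun j => d i <= j)%N f
      = \sum_(j < n) u' j * f j.
    under eq_bigr do rewrite /wsum mulr_sumr big_mkcond /=.
    rewrite exchange_big; apply: eq_bigr => j _; rewrite -big_mkcond /u' mulr_suml.
    by apply: eq_bigr => i _; rewrite mulrA.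
  rewrite !e; have [_ _ _] := ab; apply=> j.
  by apply: sumr_ge0 => i _; rewrite mulr_ge0 ?ler0n.
Qed.

End OneStep.
End Invariant.

(** * The transfer and its closed formulas *)

Section Machine.
Variables (ell : nat -> nat) (om ds : nat -> nat -> nat) (S : pred nat).

Fixpoint nsel (k n : nat) : nat :=
  if n is n'.+1 then (S k.+1 + nsel k.+1 n')%N else 0%N.

Lemma nsel_gt0 k j : S (k.+1 + j)%N -> (0 < nsel k j.+1)%N.
Proof.
elim: j k => [|j IH] k; first by rewrite addn0 /= => ->.
rewrite addnS -addSn => /IH h.
by rewrite -[nsel k _]/(S k.+1 + nsel k.+1 j.+1)%N addn_gt0 h orbT.
Qed.

Section Ring.
Context {F : comNzRingType}.
Implicit Types (v f g : nat -> F) (p q x y : F).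

Definition lsum k v : F := wsum (ell k) (om k) xpredT v.
Definition ascend k v i : F :=
  wsum (ell k.+1) (om k.+1) (fun j => ds k i <= j)%N v.
Definition descend k v i : F :=
  wsum (ell k.+1) (om k.+1) (fun j => j < ds k i)%N v.

Lemma descendE k v i : descend k v i = lsum k.+1 v - ascend k v i.
Proof.
apply/eqP; rewrite eq_sym subr_eq eq_sym addrC; apply/eqP.
rewrite /lsum (@wsumID _ _ _ _ (fun j => ds k i <= j)%N); congr (_ + _).
by apply: eq_bigl => j /=; rewrite ltnNge.
Qed.

(** The number of walks of [n] ascents from a given state at rank [k]. *)
Fixpoint asc k n : nat -> F :=
  if n is n'.+1 then ascend k (asc k.+1 n') else fun=> 1.

(** The state vectors at edge level [k], starting from [ini] at level k + n.
    With [(p, q) = (1 + x, x)] the totals give Chow polynomials; with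
    [(p, q) = (1, z)] it is the same transfer after division by powers of
    1 + x ([run_scale]). *)
Fixpoint chow_run p q (ini : (nat -> F) * (nat -> F)) k n : (nat -> F) * (nat -> F) :=
  if n is n'.+1 then
    let: (a, b) := chow_run p q ini k.+1 n' in
    if S k.+1 then
      (ascend k b, fun i => p * ascend k b i + q * descend k a i)
    else (ascend k a, ascend k b)
  else ini.

Definition consts p q : (nat -> F) * (nat -> F) := (fun=> p, fun=> q).

(** The same walk with weight [y] for every descent at a selected rank and no
    sparsity condition. *)
Fixpoint h_run y k n : nat -> F :=
  if n is n'.+1 then
    let b := h_run y k.+1 n' in
    if S k.+1 then fun i => ascend k b i + y * descend k b i
    else ascend k b
  else fun=> 1.

(** The weight x + ... + x^(c-1) of an interval of rank [c] in the recursion for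
    Chow polynomials. *)
Definition qsum x (c : nat) : F := \sum_(1 <= i < c) x ^+ i.

Lemma qsumS x c : (0 < c)%N -> qsum x c.+1 = qsum x c + x ^+ c.
Proof. by move=> c0; rewrite /qsum big_nat_recr. Qed.

Definition gsum x (c : nat) : F := \sum_(i < c) x ^+ i.

Lemma gsumS x c : gsum x c.+1 = gsum x c + x ^+ c.
Proof. by rewrite /gsum big_ord_recr. Qed.

Lemma sum_shift (n : nat) (P : pred nat) (G : nat -> F) :
  \sum_(j < n.+1 | P j) G j =
  (if P 0%N then G 0%N else 0) + \sum_(j < n | P j.+1) G j.+1.
Proof.
by rewrite big_mkcond big_ord_recl -[in LHS]big_mkcond.
Qed.

(** The common shape of all closed formulas: a sum over the selected ranks
    k + 1 + j above level [k], with ascents up to that rank. *)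
Definition rsum k n i (co h : nat -> F) : F :=
  \sum_(j < n | S (k.+1 + j)%N) co j * h j * asc k j i.

Lemma rsumS k n i co h :
  rsum k n.+1 i co h = (if S k.+1 then co 0%N * h 0%N else 0)
  + ascend k (fun i' => rsum k.+1 n i' (fun j => co j.+1) (fun j => h j.+1)) i.
Proof.
rewrite /rsum (sum_shift n (fun j => S (k.+1 + j)%N) (fun j => co j * h j * asc k j i)).
rewrite addn0 mulr1; congr (_ + _).
rewrite /ascend wsum_sum; apply: eq_big => [j|j _]; first by rewrite addnS -addSn.
by rewrite wsumZ.
Qed.

Lemma rsumD k n i co co' h :
  rsum k n i co h + rsum k n i co' h = rsum k n i (fun j => co j + co' j) h.
Proof. by rewrite /rsum -big_split; apply: eq_bigr => j _; rewrite !mulrDl. Qed.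

Lemma rsumZ k n i c co h :
  c * rsum k n i co h = rsum k n i (fun j => c * co j) h.
Proof. by rewrite /rsum mulr_sumr; apply: eq_bigr => j _; rewrite !mulrA. Qed.

Lemma eq_rsum k n i co co' h h' :
  (forall j, (j < n)%N -> S (k.+1 + j)%N -> co j * h j = co' j * h' j) ->
  rsum k n i co h = rsum k n i co' h'.
Proof. by move=> e; apply: eq_bigr => j Sj; rewrite e. Qed.

Lemma ascendD k f g i : ascend k (fun j => f j + g j) i = ascend k f i + ascend k g i.
Proof. exact: wsumD. Qed.

Lemma ascendZ k c f i : ascend k (fun j => c * f j) i = c * ascend k f i.
Proof. exact: wsumZ. Qed.

Lemma eq_ascend k f g i : f =1 g -> ascend k f i = ascend k g i.
Proof. by move=> e; apply: eq_wsum => j _. Qed.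

Section Formulas.
Variables (x al be : F).
Let ini := consts al be.
Local Notation runx := (chow_run (1 + x) x ini).

Definition heads k n : F := lsum k (runx k n).1.

(** At a selected rank, descents are all next edges minus the ascents, so
    b - a becomes x (A (b - a) + total of a); iterating this recursion gives
    the formula. *)
Lemma run_diff k n i :
  (runx k n).2 i = (runx k n).1 i
    + ((be - al) * x ^+ nsel k n * asc k n i
       + rsum k n i (fun j => x ^+ nsel k j.+1)
                    (fun j => heads (k.+1 + j) (n - j.+1))).
Proof.
elim: n k i => [|n IH] k i.
  by rewrite /= /rsum big_ord0 addr0 expr0 !mulr1 addrC subrK.
rewrite rsumS addn0 subn1.
have e i' : rsum k.+1 n i' (fun j => x ^+ nsel k j.+2)
      (fun j => heads (k.+1 + j.+1) (n.+1 - j.+2)) =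
    x ^+ S k.+1 * rsum k.+1 n i' (fun j => x ^+ nsel k.+1 j.+1)
      (fun j => heads (k.+2 + j) (n - j.+1)).
  rewrite rsumZ; apply: eq_rsum => j _ _.
  by rewrite -exprD addnS -addSn subSS.
rewrite (eq_ascend _ _ e) ascendZ {e} /=.
move: (IH k.+1); rewrite /heads; case: (runx k.+1 n) => a b /= {}IH.
case: (S k.+1) => /=; last by rewrite !add0n expr0 !mul1r add0r (eq_ascend _ _ IH) !ascendD ascendZ.
rewrite descendE (eq_ascend _ _ IH) !ascendD ascendZ.
rewrite !exprS !expr0 -/(heads _ _); ring.
Qed.

(** At a selected rank the new a is A b = A a + A (b - a), where [run_diff]
    supplies b - a: each geometric sum thus gains one more power of x. *)
Lemma run_fst k n i :
  (runx k n).1 i =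
    (al + (be - al) * gsum x (nsel k n)) * asc k n i
    + rsum k n i (fun j => qsum x (nsel k j.+1))
                 (fun j => heads (k.+1 + j) (n - j.+1)).
Proof.
elim: n k i => [|n IH] k i.
  by rewrite /rsum /gsum !big_ord0 !mulr0 !addr0 mulr1.
rewrite rsumS addn0 subn1.
have -> : (if S k.+1 then qsum x (nsel k 1) * heads k.+1 n.+1.-1 else 0) = 0.
  by case: ifP => //= ->; rewrite /qsum big_geq // mul0r.
rewrite add0r.
have D i' := run_diff k.+1 n i'.
move: (IH k.+1); move: D; rewrite [X in X.1 i]/=; case: (runx k.+1 n) => a b /= D {}IH.
case: ifP => Sk /=; last first.
  rewrite add0n (eq_ascend _ _ IH) ascendD ascendZ; congr (_ + _).
  apply: eq_wsum => i' _; apply: eq_rsum => j _ _.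
  by rewrite addnS -addSn subSS.
have e i' : rsum k.+1 n i' (fun j => qsum x (S k.+1 + nsel k.+1 j.+1))
      (fun j => heads (k.+1 + j.+1) (n.+1 - j.+2)) =
    rsum k.+1 n i' (fun j => qsum x (nsel k.+1 j.+1))
      (fun j => heads (k.+2 + j) (n - j.+1)) +
    rsum k.+1 n i' (fun j => x ^+ nsel k.+1 j.+1)
      (fun j => heads (k.+2 + j) (n - j.+1)).
  rewrite rsumD; apply: eq_rsum => j jn Sj.
  by rewrite addnS -addSn subSS Sk add1n qsumS // nsel_gt0.
rewrite Sk in e *.
rewrite (eq_ascend _ _ e) (eq_ascend _ _ D) ascendD (eq_ascend _ _ IH).
rewrite !ascendD !ascendZ add1n gsumS; ring.
Qed.

Lemma lsum_asc k n c co h :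
  lsum k (fun i => c * asc k n i + rsum k n i co h) =
  c * lsum k (asc k n) + \sum_(j < n | S (k.+1 + j)%N) co j * h j * lsum k (asc k j).
Proof.
rewrite /lsum wsumD wsumZ wsum_sum; congr (_ + _); apply: eq_bigr => j _.
exact: wsumZ.
Qed.

(** This is the recursion of [chow_above_qsum] on ranks: for the initial pair
    (1, 1 + x) the first term collects its constant and the contribution of
    the top element. *)
Lemma headsE k n :
  heads k n = (al + (be - al) * gsum x (nsel k n)) * lsum k (asc k n) +
    \sum_(j < n | S (k.+1 + j)%N) qsum x (nsel k j.+1) *
       heads (k.+1 + j) (n - j.+1) * lsum k (asc k j).
Proof.
rewrite -(lsum_asc k n _ (fun j => qsum x (nsel k j.+1)) (fun j => heads (k.+1 + j) (n - j.+1))).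
by apply: eq_wsum => i _; rewrite run_fst.
Qed.

Lemma lsum_run2 k n :
  lsum k (runx k n).2 =
    heads k n + (be - al) * x ^+ nsel k n * lsum k (asc k n) +
    \sum_(j < n | S (k.+1 + j)%N) x ^+ nsel k j.+1 *
       heads (k.+1 + j) (n - j.+1) * lsum k (asc k j).
Proof.
rewrite -addrA -(lsum_asc k n _ (fun j => x ^+ nsel k j.+1) (fun j => heads (k.+1 + j) (n - j.+1))).
by rewrite -wsumD; apply: eq_wsum => i _; rewrite run_diff.
Qed.

End Formulas.

Section HFormula.
Variable y : F.
Definition hheads k n : F := lsum k (h_run y k n).

Lemma hrunE k n i :
  h_run y k n i = (1 - y) ^+ nsel k n * asc k n i
    + rsum k n i (fun j => (1 - y) ^+ (nsel k j.+1).-1 * y)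
                 (fun j => hheads (k.+1 + j) (n - j.+1)).
Proof.
elim: n k i => [|n IH] k i.
  by rewrite /rsum big_ord0 addr0 expr0 mulr1.
rewrite rsumS addn0 subn1 /=.
case: ifP => Sk /=; last first.
  rewrite !add0n add0r (eq_ascend _ _ (IH _)) ascendD ascendZ; congr (_ + _).
  apply: eq_wsum => i' _; apply: eq_rsum => j _ _.
  by rewrite addnS -addSn subSS.
have e i' : rsum k.+1 n i' (fun j => (1 - y) ^+ (1 + nsel k.+1 j.+1).-1 * y)
      (fun j => hheads (k.+1 + j.+1) (n.+1 - j.+2)) =
    (1 - y) * rsum k.+1 n i' (fun j => (1 - y) ^+ (nsel k.+1 j.+1).-1 * y)
      (fun j => hheads (k.+2 + j) (n - j.+1)).
  rewrite rsumZ; apply: eq_rsum => j jn Sj.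
  rewrite addnS -addSn subSS add1n.
  move: (nsel_gt0 Sj); case: (nsel k.+1 j.+1) => // c _.
  by rewrite exprS !mulrA.
rewrite (eq_ascend _ _ e) ascendZ descendE (eq_ascend _ _ (IH _)) ascendD ascendZ.
rewrite -/(hheads _ _) !add0n add1n exprS !expr0 /=; ring.
Qed.

Lemma hheadsE k n :
  hheads k n = (1 - y) ^+ nsel k n * lsum k (asc k n) +
    \sum_(j < n | S (k.+1 + j)%N) (1 - y) ^+ (nsel k j.+1).-1 * y *
       hheads (k.+1 + j) (n - j.+1) * lsum k (asc k j).
Proof.
rewrite -(lsum_asc k n _ (fun j => (1 - y) ^+ (nsel k j.+1).-1 * y) (fun j => hheads (k.+1 + j) (n - j.+1))).
by apply: eq_wsum => i _; rewrite hrunE.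
Qed.

End HFormula.
End Ring.
End Machine.

(** * Nonvanishing of the transfer *)

Section Nonvanishing.
Context {C : numClosedFieldType}.
Variables (ell : nat -> nat) (om ds : nat -> nat -> nat) (S : pred nat) (l : nat).
Hypothesis ds_mono : forall k i j, (k < l)%N -> (i <= j < ell k)%N ->
  (ds k i <= ds k j)%N.
Local Notation lsum := (@lsum ell om C).
Local Notation ascend := (@ascend ell om ds C).
Local Notation descend := (@descend ell om ds C).
Local Notation asc := (@asc ell om ds C).
Local Notation chow_run := (@chow_run ell om ds S C).
Local Notation h_run := (@h_run ell om ds S C).
Local Notation nsel := (nsel S).

Lemma wsum_neq0P n w Q (f : nat -> C) : wsum n w Q f != 0 ->
  exists2 j : 'I_n, Q j & (w j)%:R * f j != 0.
Proof.
move=> nz; case: (pickP (fun j : 'I_n => Q j && ((w j)%:R * f j != 0))).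
  by move=> j /andP[]; exists j.
move=> h; case/eqP: nz; apply: big1 => j Qj; apply/eqP.
by have := h j; rewrite Qj /= => /negbFE.
Qed.

Variable z : C.
Hypothesis zP : salient z.

Lemma wsum_neq0 n w Q (f g : nat -> C) :
  (forall i j, (i <= j < n)%N -> between z (f i) (f j)) ->
  (forall j, (j < n)%N -> g j != 0 -> f j != 0) ->
  wsum n w Q g != 0 -> wsum n w Q f != 0.
Proof.
move=> ff gf /wsum_neq0P[j Qj]; rewrite mulf_eq0 => /norP[wj gj].
apply: (@between_sum_neq0 _ z n _ (fun j => (w j)%:R) (fun j => f j) j) => //.
- by move=> i i' _ _ lt; apply: ff; rewrite (ltnW lt) ltn_ord.
- by rewrite mulf_neq0 // gf.
Qed.

(** The state vector is nonzero on all states from which ascents lead to the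
    last level.  On other states it may well vanish. *)
Definition nonvanishing k n (b : nat -> C) : Prop :=
  forall i, (i < ell k)%N -> asc k n i != 0 -> b i != 0.

Lemma ascend_good k n f : (forall i j, (i <= j < ell k.+1)%N -> between z (f i) (f j)) ->
  nonvanishing k.+1 n f -> nonvanishing k n.+1 (ascend k f).
Proof. by move=> ff gf i ik; apply: wsum_neq0. Qed.

Lemma select_good k n a b : compatible z (ell k.+1) a b -> nonvanishing k.+1 n b ->
  nonvanishing k n.+1 (fun i => ascend k b i + z * descend k a i).
Proof.
move=> ab gb i ik nz; apply/negP => /eqP e.
have [bb _ _ _] := ab.
have /negP[] := ascend_good bb gb ik nz; apply/eqP.
by case: (between_add_eq0 zP _ e) => //; exact/between_rot/below_above.
Qed.

Lemma compatible_ext n a a' b b' : a =1 a' -> b =1 b' ->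
  compatible z n a b -> compatible z n a' b'.
Proof.
move=> ea eb [h1 h2 h3 h4]; split=> [i j|i j|i j|u u0].
- by rewrite -!eb; exact: h1.
- by rewrite -!ea; exact: h2.
- by rewrite -ea -eb; exact: h3.
- under eq_bigr do rewrite -ea.
  by under [X in between _ _ X]eq_bigr do rewrite -eb; exact: h4.
Qed.

Lemma run_compatible al k n : (k + n)%N = l -> al = 0 \/ al = 1 ->
  let ab := chow_run 1 z (consts al 1) k n in
  [/\ compatible z (ell k) ab.1 ab.2, nonvanishing k n ab.2 & al = 1 -> nonvanishing k n ab.1].
Proof.
move=> + alP; elim: n k => [|n IH] k kn /=.
  split; last 2 first.
  - by move=> i _ _; exact: oner_neq0.
  - by move=> -> i _ _; exact: oner_neq0.
  case: alP => ->; last by apply: compatible_diag => *; exact: between_refl.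
  split=> [*|*|*|u u0]; try exact: between_refl; first exact: between0l.
  by under eq_bigr do rewrite mulr0; rewrite big1 //; exact: between0l.
have kl : (k < l)%N by lia.
have := IH k.+1; rewrite addSnnS => /(_ kn).
case: (chow_run 1 z _ k.+1 n) => a b [/= ab gb ga]; have [bb aa _ _] := ab.
have d_mono i j : (i <= j < ell k)%N -> (ds k i <= ds k j)%N by exact: ds_mono.
have e i : 1 * ascend k b i + z * descend k a i = ascend k b i + z * descend k a i.
  by rewrite mul1r.
case: ifP => Sk; split=> /=.
- by apply: compatible_ext (compatible_select _ ab d_mono) => // i; rewrite e.
- by move=> i ik nz; rewrite e; exact: (select_good ab gb).
- by move=> _; exact: ascend_good.
- exact: compatible_skip.
- exact: ascend_good.
- by move=> al1; exact/ascend_good/ga.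
Qed.

Lemma hrun_compatible k n : (k + n)%N = l ->
  (forall i j, (i <= j < ell k)%N -> between z (h_run z k n i) (h_run z k n j)) /\
  nonvanishing k n (h_run z k n).
Proof.
elim: n k => [|n IH] k kn /=.
  by split=> [*|i _ _]; [exact: between_refl|exact: oner_neq0].
have kl : (k < l)%N by lia.
have := IH k.+1; rewrite addSnnS => /(_ kn).
move: (h_run z k.+1 n) => b [bb gb]; have ab := compatible_diag bb.
have d_mono i j : (i <= j < ell k)%N -> (ds k i <= ds k j)%N by exact: ds_mono.
case: ifP => Sk; split.
- by have [] := compatible_select (om k.+1) ab d_mono.
- exact: (select_good ab gb).
- by have [] := compatible_skip (om k.+1) ab d_mono.
- exact: ascend_good.
Qed.

End Nonvanishing.

Section Scaling.
Context {C : numClosedFieldType}.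
Variables (ell : nat -> nat) (om ds : nat -> nat -> nat) (S : pred nat).
Variable x : C.
Hypothesis x1 : 1 + x != 0.
Let z := x / (1 + x) ^+ 2.

(** Substituting x = z (1 + x)^2 makes both components homogeneous, b having
    one factor 1 + x more than a. *)
Lemma run_scale al k n :
  let ab := chow_run ell om ds S (1 + x) x (consts al (1 + x)) k n in
  let ab' := chow_run ell om ds S 1 z (consts al 1) k n in
  (forall i, ab.1 i = (1 + x) ^+ nsel S k n * ab'.1 i) /\
  (forall i, ab.2 i = (1 + x) ^+ (nsel S k n).+1 * ab'.2 i).
Proof.
elim: n k => [|n IH] k /=; first by split=> i; rewrite ?expr0 ?expr1 ?mul1r ?mulr1.
have := IH k.+1; case: (chow_run _ _ _ _ _ _ _ _ _) => a b /=.
case: (chow_run _ _ _ _ _ _ _ _ _) => a' b' /= [ea eb].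
have xz : x = z * (1 + x) ^+ 2 by rewrite mulfVK // expf_neq0.
pose c := 1 + x; rewrite -/c in xz ea eb *.
case: ifP => Sk /=.
  rewrite add1n; split=> i; rewrite (eq_ascend _ _ _ _ _ eb) ascendZ //.
  rewrite /descend (eq_wsum _ _ (fun j _ => ea j)) wsumZ !exprS -/(ascend ell om ds k b' i).
  by rewrite -/c xz; ring.
by rewrite add0n; split=> i; rewrite ?(eq_ascend _ _ _ _ _ ea) ?(eq_ascend _ _ _ _ _ eb) ascendZ.
Qed.

End Scaling.

Section Conclusion.
Context {C : numClosedFieldType}.
Variables (ell : nat -> nat) (om ds : nat -> nat -> nat) (S : pred nat) (k n : nat).
Hypothesis ds_mono : forall m i j, (m < k + n)%N -> (i <= j < ell m)%N ->
  (ds m i <= ds m j)%N.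
Hypothesis lsum_nz : lsum ell om k (asc ell om ds k n) != 0 :> C.

Local Notation chow_run x al := (chow_run ell om ds S (1 + x) x (consts al (1 + x)) k n).
Local Notation lsum := (@lsum ell om C).

Lemma lsum_neq0 z f : salient z ->
  (forall i j, (i <= j < ell k)%N -> between z (f i) (f j)) ->
  nonvanishing ell om ds k n f -> lsum k f != 0.
Proof. by move=> zP ff gf; apply: (wsum_neq0 zP ff _ lsum_nz) => j; exact: gf. Qed.

Lemma hrun_neq0 z : salient z -> lsum k (h_run ell om ds S z k n) != 0.
Proof.
by move=> zP; have [bb gb] := hrun_compatible om S ds_mono zP erefl; exact: (lsum_neq0 zP).
Qed.

Lemma run_neq0 x al : 1 + x != 0 -> salient (x / (1 + x) ^+ 2) -> al = 0 \/ al = 1 ->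
  (al = 1 -> lsum k (chow_run x al).1 != 0) /\ lsum k (chow_run x al).2 != 0.
Proof.
move=> x1 zP alP; have [/= ea eb] := run_scale ell om ds S x1 al k n.
have [[bb aa _ _] gb ga] := run_compatible om S ds_mono zP erefl alP.
rewrite /lsum (eq_wsum _ _ (fun j _ => ea j)) (eq_wsum _ _ (fun j _ => eb j)) !wsumZ.
have c0 m : (1 + x) ^+ m != 0 by rewrite expf_neq0.
split=> [al1|]; rewrite mulf_neq0 //; first exact: (lsum_neq0 zP aa (ga al1)).
exact: (lsum_neq0 zP bb gb).
Qed.

(** The one factor 1 + x by which b exceeds a turns the cone spanned by 1 and
    z = x / (1 + x)^2 into the cone spanned by 1 + x and x / (1 + x), which
    lies in the upper half-plane when x does. *)
Lemma run_between x : 1 + x != 0 -> salient (x / (1 + x) ^+ 2) ->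
  exists s t : C, [/\ 0 <= s, 0 <= t &
    lsum k (chow_run x 1).2 * (lsum k (chow_run x 1).1)^* = s * (1 + x) + t * (x / (1 + x))].
Proof.
move=> x1 zP; have [/= ea eb] := run_scale ell om ds S x1 1 k n.
have [ab _ _] := run_compatible om S ds_mono zP erefl (or_intror (erefl (1:C))).
have := compatible_wsum (om k) ab xpredT.
rewrite /lsum (eq_wsum _ _ (fun j _ => ea j)) (eq_wsum _ _ (fun j _ => eb j)) !wsumZ.
set A := wsum _ _ _ _; set B := wsum _ _ _ _ => -[s [t [s0 t0 e]]].
pose c := (1 + x) ^+ nsel S k n * ((1 + x) ^+ nsel S k n)^*.
have c0 : 0 <= c by exact: mul_conjC_ge0.
exists (c * s), (c * t); split; [exact: mulr_ge0|exact: mulr_ge0|].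
rewrite rmorphM exprS /=.
transitivity (c * (1 + x) * (B * A^*)); first by rewrite /c; ring.
by rewrite e; field.
Qed.

End Conclusion.

(** * Multiplicities from the sign of an imaginary part *)

Section UpperHalfPlane.
Context {C : numClosedFieldType}.
Implicit Types u : C.

Lemma i_not_real : ('i : C) \is Num.real = false.
Proof. by apply/negP => /Creal_ImP/eqP; rewrite Im_i oner_eq0. Qed.

(** A k-th root with nonnegative imaginary part exists once k > 1, and it is not
    real since its power is not. *)
Lemma upper_root k w : (1 < k)%N -> w \isn't Num.real ->
  exists u, 0 < 'Im u /\ u ^+ k = w :> C.
Proof.
move=> k1 wr; have k0 : (0 < k)%N by exact: ltnW.
exists (k.-root w); rewrite rootCK //; split=> //.
rewrite lt_neqAle Im_rootC_ge0 // andbT eq_sym; apply/negP => /eqP/Creal_ImP ur.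
by case/negP: wr; rewrite -(rootCK k0 w); exact: rpredX.
Qed.

Lemma upper_root_i k : (0 < k)%N -> exists u, 0 < 'Im u /\ u ^+ k = 'i :> C.
Proof.
rewrite leq_eqVlt => /predU1P[<-|k1]; last by apply: upper_root; rewrite ?i_not_real.
by exists 'i; rewrite Im_i ltr01.
Qed.

Lemma upper_root_Ni k : (1 < k)%N -> exists u, 0 < 'Im u /\ u ^+ k = - 'i :> C.
Proof. by move=> k1; apply: upper_root; rewrite // rpredN i_not_real. Qed.

Lemma Re_pos_near0 (P : {poly C}) : 0 < P.[0] -> exists e, 0 < e /\ 0 < 'Re P.[e].
Proof.
move=> P0; have : root (P - (P.[0])%:P) 0 by rewrite rootE !hornerE subrr.
case/factor_theorem => Q; rewrite subr0 => /eqP; rewrite subr_eq => /eqP eP.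
pose M := \sum_(i < size Q) `|Q`_i|.
have M0 : 0 <= M by apply: sumr_ge0.
(* Small enough that the higher terms, at most [e * M], stay below [P.[0]]. *)
pose e := P.[0] / (P.[0] + M + 1).
have d0 : 0 < P.[0] + M + 1 by rewrite -addrA ltr_pwDl // addr_ge0.
have e0 : 0 < e by rewrite divr_gt0.
have e1 : e <= 1 by rewrite ler_pdivrMr // mul1r -addrA lerDl addr_ge0.
have QM : `|Q.[e]| <= M.
  rewrite horner_coef; apply: le_trans (ler_norm_sum _ _ _) _; apply: ler_sum => i _.
  rewrite normrM ler_piMr // normrX (ger0_norm (ltW e0)).
  by rewrite exprn_ile1 // ltW.
have small : `|Q.[e] * e| < P.[0].
  rewrite normrM (ger0_norm (ltW e0)) /e mulrA ltr_pdivrMr // mulrC.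
  rewrite ltr_pM2l //; apply: le_lt_trans QM _.
  by rewrite addrAC ltr_pwDl // addr_gt0.
have eh : P.[e] = Q.[e] * e + P.[0] by rewrite [in LHS]eP !hornerE.
exists e; split=> //; rewrite eh raddfD /= [X in _ + X](Creal_ReP _ _) ?gtr0_real //.
rewrite -ltrBlDl sub0r; apply: le_lt_trans small.
move: (Q.[e] * e) => w; apply: le_trans (leif_normC_Re_Creal w).
by rewrite -normrN; apply/real_ler_norm; rewrite rpredN Creal_Re.
Qed.

End UpperHalfPlane.

Section LocalMultiplicities.
Context {R : rcfType}.
Implicit Types (s t : seq R) (c : R).
Local Notation rc := (real_complex R).

Definition above c s : nat := count (fun a => c < a) s.

Lemma above_sign c s :
  0 < (-1) ^+ above c s * \prod_(a <- s | a != c) (c - a).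
Proof.
elim: s => [|a s IH]; first by rewrite big_nil expr0 mulr1 ltr01.
rewrite big_cons /above /= -/(above c s) exprD; case: (ltgtP c a) => [ca|ac|ca] /=.
- rewrite expr1 mulN1r mulNr mulrCA -mulNr pmulr_rgt0 //.
  by rewrite oppr_gt0 subr_lt0.
- by rewrite expr0 mul1r mulrCA pmulr_rgt0 // subr_gt0.
- by rewrite expr0 mul1r.
Qed.

Definition eval_roots s (x : R[i]) : R[i] := \prod_(a <- s) (x - rc a).

Lemma eval_roots_split c s (w : R[i]) :
  eval_roots s (rc c + w) =
  w ^+ count_mem c s * \prod_(a <- s | a != c) (rc (c - a) + w).
Proof.
elim: s => [|a s IH]; first by rewrite /eval_roots !big_nil mulr1.
rewrite /eval_roots !big_cons /= -/(eval_roots _ _) IH exprD.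
case: eqVneq => [->|ac] /=.
  by rewrite expr1 addrC addKr mulrA.
by rewrite expr0 mul1r rmorphB /= addrAC mulrCA.
Qed.

Lemma conj_rc c : (rc c)^* = rc c.
Proof. by rewrite conj_Creal //; apply/complex_realP; exists c. Qed.

(** Approach c along c + e u with e decreasing to 0.  Both values factor as a
    power of [e u] times a factor tending to a nonzero real number, whose
    sign is given by the number of roots above c.  So the direction u must not
    turn the leading term into a number of negative imaginary part. *)
Lemma local_contra s t c (u rho : R[i]) :
  (forall x : R[i], 0 < 'Im x -> 0 <= 'Im (eval_roots t x * (eval_roots s x)^*)) ->
  0 < 'Im u -> 0 < rho ->
  u ^+ count_mem c t * u^* ^+ count_mem c s
    = - 'i * ((-1) ^+ (above c s + above c t) * rho) -> False.
Proof.
move=> st u0 rho0 eu.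
set sg := (-1) ^+ _ in eu.
pose P := \prod_(b <- t | b != c) ((rc (c - b))%:P + u *: 'X) *
          \prod_(a <- s | a != c) ((rc (c - a))%:P + u^* *: 'X).
have P0 : (sg *: P).[0] = rc ((-1) ^+ above c s * \prod_(a <- s | a != c) (c - a) *
                  ((-1) ^+ above c t * \prod_(a <- t | a != c) (c - a))).
  have e0 (v : R[i]) l : (\prod_(a <- l | a != c) ((rc (c - a))%:P + v *: 'X)).[0]
      = rc (\prod_(a <- l | a != c) (c - a)).
    by rewrite horner_prod rmorph_prod; apply: eq_bigr => a _; rewrite !hornerE.
  rewrite hornerZ hornerM !e0 -rmorphM /= /sg -(rmorph1 rc) -rmorphN -rmorphXn -rmorphM /=.
  by congr real_complex_def; rewrite exprD; ring.
have [] := @Re_pos_near0 _ (sg *: P).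
  by rewrite P0 ltcR mulr_gt0 // above_sign.
move=> e [e0 Re0].
have er : e \is Num.real by exact: gtr0_real.
have := st (rc c + e * u); rewrite raddfD /= ImMl // (Creal_ImP _ _) ?add0r; last first.
  by apply/complex_realP; exists c.
rewrite pmulr_rgt0 // => /(_ u0).
rewrite !eval_roots_split rmorphM rmorphXn rmorph_prod /= rmorphM /= (conj_Creal er).
have -> : \prod_(a <- s | a != c) (rc (c - a) + e * u)^* =
          (\prod_(a <- s | a != c) ((rc (c - a))%:P + u^* *: 'X)).[e].
  rewrite horner_prod; apply: eq_bigr => a _.
  by rewrite rmorphD rmorphM /= conj_rc (conj_Creal er) !hornerE mulrC.
have -> : \prod_(a <- t | a != c) (rc (c - a) + e * u) =
          (\prod_(a <- t | a != c) ((rc (c - a))%:P + u *: 'X)).[e].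
  by rewrite horner_prod; apply: eq_bigr => a _; rewrite !hornerE mulrC.
rewrite !exprMn; set p := count_mem c s in eu *; set q := count_mem c t in eu *.
set B := _.[e]; set A := _.[e].
have -> : e ^+ q * u ^+ q * B * (e ^+ p * u^* ^+ p * A) =
  e ^+ (p + q) * (u ^+ q * u^* ^+ p) * (P.[e]).
  by rewrite /P hornerM exprD -/A -/B; ring.
rewrite eu.
have -> : e ^+ (p + q) * (- 'i * (sg * rho)) * P.[e] =
   - (e ^+ (p + q) * rho) * ('i * (sg * P.[e])) by ring.
rewrite -hornerZ ImMl ?ImMil; last first.
  by rewrite rpredN; apply: gtr0_real; rewrite mulr_gt0 // exprn_gt0.
by rewrite mulNr oppr_ge0 pmulr_rle0 ?mulr_gt0 ?exprn_gt0 // (lt_geF Re0).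
Qed.

(** If the multiplicities differed otherwise, some direction u in the upper
    half-plane, a root of i or of -i, would violate [local_contra]. *)
Lemma local_multiplicity s t c :
  (forall x : R[i], 0 < 'Im x -> 0 <= 'Im (eval_roots t x * (eval_roots s x)^*)) ->
  let p := count_mem c s in let q := count_mem c t in
  if odd (above c s + above c t) then q = p \/ p = q.+1 else q = p \/ q = p.+1.
Proof.
move=> st p q.
have K := @local_contra s t c _ _ st.
rewrite -signr_odd -/p -/q in K.
have uu (u : R[i]) m : 0 < 'Im u -> 0 < (u * u^*) ^+ m.
  move=> u0; rewrite exprn_gt0 // lt_def mul_conjC_ge0 andbT mul_conjC_eq0.
  by apply: contraTneq u0 => ->; rewrite raddf0 ltxx.
have [pq|qp] := leqP p q.
  have e u : u ^+ q * u^* ^+ p = (u * u^*) ^+ p * u ^+ (q - p).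
    by rewrite exprMn -{1}(subnK pq) exprD; ring.
  case: ifP K => _ K.
    have [|m0] := posnP (q - p); first by left; lia.
    have [u [u0 eu]] := @upper_root_i R[i] _ m0.
    case: (K u _ u0 (uu u p u0)); rewrite e eu; ring.
  have [m1|m1] := leqP (q - p) 1; first by lia.
  have [u [u0 eu]] := @upper_root_Ni R[i] _ m1.
  by case: (K u _ u0 (uu u p u0)); rewrite e eu; ring.
have e u : u ^+ q * u^* ^+ p = (u * u^*) ^+ q * (u ^+ (p - q))^*.
  by rewrite exprMn -{1}(subnK (ltnW qp)) exprD rmorphXn /=; ring.
case: ifP K => _ K.
  have [m1|m1] := leqP (p - q) 1; first by lia.
  have [u [u0 eu]] := @upper_root_Ni R[i] _ m1.
  by case: (K u _ u0 (uu u q u0)); rewrite e eu rmorphN /= conjCi; ring.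
have m0 : (0 < p - q)%N by lia.
have [u [u0 eu]] := @upper_root_i R[i] _ m0.
by case: (K u _ u0 (uu u q u0)); rewrite e eu conjCi; ring.
Qed.

End LocalMultiplicities.

(** * Interlacing of root lists *)

Section Interlacing.
Context {R : realType}.
Implicit Types (s t : seq R) (c : R).
Local Notation rc := (real_complex R).

(** Used to move c down from one root to the next: [c'] is the lowest root
    above [c]. *)
Lemma next_root c s : (0 < above c s)%N ->
  exists c', [/\ c < c', (above c' s < above c s)%N &
    forall u, subseq u s -> above c u = (above c' u + count_mem c' u)%N].
Proof.
rewrite -has_count => hs.
pose l := [seq a <- s | c < a].
have l0 : l != [::] by rewrite -size_eq0 size_filter -lt0n -has_count.
have : sorted <=%O (sort <=%O l) by apply: sort_sorted; exact: le_total.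
case el : (sort <=%O l) => [|c' l'] sl.
  by move: l0; rewrite -size_eq0 -(size_sort <=%O) el.
have c'l : c' \in l by rewrite -(mem_sort <=%O) el mem_head.
have min a : a \in s -> c < a -> c' <= a.
  move=> sa ca; have : a \in sort <=%O l by rewrite mem_sort mem_filter ca.
  rewrite el inE => /predU1P[->//|al'].
  by move: sl => /= /order_path_min - /(_ le_trans)/allP/(_ _ al').
move: c'l; rewrite mem_filter => /andP[cc' c's].
have split u : subseq u s -> above c u = (above c' u + count_mem c' u)%N.
  move=> us; rewrite /above -count_predUI [X in (_ + X)%N](_ : _ = 0%N) ?addn0.
    apply/eq_in_count => a /(mem_subseq us) as_ /=.
    apply/idP/orP => [ca|[c'a|/eqP->//]]; last exact: lt_trans c'a.
    by have := min _ as_ ca; rewrite le_eqVlt eq_sym => /orP[->|->]; [right|left].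
  by apply/eqP; rewrite -leqn0 leqNgt -has_count; apply/hasPn => a _ /=; case: ltgtP.
exists c'; split=> //.
by rewrite (split s (subseq_refl s)) -[ltnLHS]addn0 ltn_add2l -has_count has_pred1.
Qed.

(** Start above all roots, where both numbers are 0.  At each root
    [local_multiplicity] allows only steps between difference 0 and
    difference 1, since the parity of the sum is that of the difference. *)
Lemma above_interlace s t :
  (forall x : R[i], 0 < 'Im x -> 0 <= 'Im (eval_roots t x * (eval_roots s x)^*)) ->
  forall c, above c t = above c s \/ above c t = (above c s).+1.
Proof.
move=> st c; have [m] := ubnP (above c (s ++ t)); elim: m c => // m IH c cm.
have [c0|] := posnP (above c (s ++ t)).
  by move: c0; rewrite /above count_cat => /eqP; rewrite addn_eq0 => /andP[/eqP-> /eqP->]; left.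
case/next_root => c' [cc' lt sp].
have := IH c' (leq_trans lt cm).
rewrite (sp s (prefix_subseq _ _)) (sp t (suffix_subseq _ _)).
case=> E; have /= := local_multiplicity c' st;
  rewrite E ?addnS /= addnn odd_double /= => -[] ->; rewrite ?addnS ?addSn; tauto.
Qed.

(** In a decreasing list the entries exceeding [c] come first; this
    translates between counts and entries. *)
Lemma lt_nth_above c s i : sorted >=%R s -> (i < size s)%N ->
  (c < s`_i) = (i < above c s)%N.
Proof.
elim: s i => //= a s IH i sa.
have sle : all (fun b => b <= a) s by apply: order_path_min sa => x y z xy yz; exact: le_trans xy.
have ss := path_sorted sa.
case: i => [_|i] /=; last rewrite ltnS => lti.
  rewrite /above /=; case: ltP => //= ac; apply/esym/negbTE; rewrite -leqNgt leqn0.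
  rewrite eqn0Ngt -has_count; apply/hasPn => b /(allP sle) ba.
  by rewrite -leNgt (le_trans ba).
rewrite IH // /above /=; case: ltP => //= ac; rewrite ?add1n ?ltnS // add0n.
have -> : count (fun a => c < a) s = 0%N; last by rewrite !ltn0.
apply/eqP; rewrite eqn0Ngt -has_count; apply/hasPn => b /(allP sle) ba.
by rewrite -leNgt (le_trans ba).
Qed.

Lemma interlace_lists s t : sorted >=%R s -> sorted >=%R t ->
  (forall c, above c t = above c s \/ above c t = (above c s).+1) ->
  [/\ size t = size s \/ size t = (size s).+1,
      forall i, (i < size s)%N -> s`_i <= t`_i &
      forall i, (i.+1 < size t)%N -> t`_i.+1 <= s`_i].
Proof.
move=> ss st h.
have sz : size t = size s \/ size t = (size s).+1.
  (* A point below all roots, where the two counts are the sizes. *)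
pose c := \big[Num.min/0]_(a <- s ++ t) a - 1.
  have cP u : {subset u <= s ++ t} -> above c u = size u.
    move=> us; apply/eqP; rewrite /above -all_count; apply/allP => a /us au.
    rewrite ltrBlDr ltr_pwDr //.
    elim: (s ++ t) au => // b l IH; rewrite inE big_cons ge_min.
    by case/predU1P => [->|/IH ->]; rewrite ?lexx ?orbT.
  by have := h c; rewrite !cP // => a; rewrite mem_cat => ->; rewrite ?orbT.
split=> // i lti; rewrite leNgt; apply/negP => lt.
- have [it|ti] := ltnP i (size t); last by lia.
  have := lt_nth_above t`_i ss lti; have := lt_nth_above t`_i st it.
  by rewrite ltxx lt; have := h t`_i; lia.
- have [it|ti] := ltnP i (size s); last by lia.
  have := lt_nth_above s`_i ss it; have := lt_nth_above s`_i st lti.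
  by rewrite ltxx lt; have := h s`_i; lia.
Qed.

Lemma real_roots_of (f : {poly R}) : nonpos_real_roots f -> exists s, roots_of f s.
Proof.
move=> fP; have f0 : f != 0.
  apply: contraPneq fP => -> /(_ 1); rewrite rmorph0 root0 => /(_ isT)[a].
  by rewrite -(rmorph1 rc) => /complexI <-; rewrite ler10.
have [r er] := closed_field_poly_normal (map_poly rc f).
have lc0 : lead_coef (map_poly rc f) != 0 by rewrite lead_coef_eq0 map_poly_eq0.
have [s es] : exists s, r = map rc s.
  have : forall z, z \in r -> exists a, z = rc a.
    move=> z zr; have [|a -> _] := fP z; last by exists a.
    by rewrite er rootZ // root_prod_XsubC.
  elim: r {er} => [|z r IH] h; first by exists [::].
  have [a ->] := h z (mem_head _ _).
  have [|s ->] := IH; last by exists (a :: s).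
  by move=> w wr; apply: h; rewrite inE wr orbT.
exists (sort >=%R s); split=> //; last by apply: sort_sorted => x y; exact: le_total.
apply: (map_poly_inj rc); rewrite [LHS]er lead_coef_map es big_map.
rewrite map_polyZ rmorph_prod; congr (_ *: _).
rewrite (perm_big _ (permEl (perm_sort _ _))) /=; apply: eq_bigr => a _.
by rewrite map_polyXsubC.
Qed.

Lemma interlaces_upper (f g : {poly R}) :
  nonpos_real_roots f -> nonpos_real_roots g ->
  0 < lead_coef f -> 0 < lead_coef g ->
  (forall x : R[i], 0 < 'Im x ->
    0 <= 'Im ((map_poly rc g).[x] * ((map_poly rc f).[x])^*)) ->
  interlaces f g.
Proof.
move=> /real_roots_of[s [f0 ef ss]] /real_roots_of[t [g0 eg st]] lf lg fg.
split=> //; exists s, t.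
have ev (p : {poly R}) l x : p = lead_coef p *: \prod_(a <- l) ('X - a%:P) ->
    (map_poly rc p).[x] = rc (lead_coef p) * eval_roots l x.
  move=> {1}->; rewrite map_polyZ hornerZ rmorph_prod horner_prod; congr (_ * _).
  by apply: eq_bigr => a _; rewrite /= map_polyXsubC !hornerE.
suff /(above_interlace) h : forall x : R[i], 0 < 'Im x ->
    0 <= 'Im (eval_roots t x * (eval_roots s x)^*).
  by have [] := interlace_lists ss st h.
move=> x /fg; rewrite (ev _ _ _ ef) (ev _ _ _ eg) rmorphM /= conj_rc.
rewrite mulrACA -rmorphM ImMl; last by apply/complex_realP; exists (lead_coef g * lead_coef f).
by rewrite pmulr_rge0 // ltcR mulr_gt0.
Qed.

End Interlacing.

(** * Recursions for Chow polynomials *)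

Section ChowRecursion.
Context (R : realType) {d : Order.disp_t} {T : finTBPOrderType d}.
Implicit Types s t w : T.
Local Notation H := (chow_above R).
Local Notation gs s t := (gsum ('X : {poly R}) (rank t - rank s)).
Local Notation mu s t := ((mobius s t)%:~R : R).

Lemma red_charpolyE s t : (s < t)%O ->
  red_charpoly R s t = \sum_(w : T | (s <= w <= t)%O) mu s w *: gs w t.
Proof.
move=> st; apply: (@mulIf _ ('X - 1)).
  by rewrite -size_poly_eq0 size_XsubC.
rewrite red_charpolyM // mulr_suml /charpoly.
under [RHS]eq_bigr do rewrite -scalerAl mulrC -subrX1 scalerBr.
rewrite big_split /= -[LHS]addr0; congr (_ + _).
rewrite sumrN -scaler_suml -[X in - (X *: _)]rmorph_sum /=.
by rewrite mobius_sum0 // rmorph0 scale0r oppr0.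
Qed.

Lemma up_ind (Q : T -> Prop) :
  (forall s, (forall w, (s < w)%O -> Q w) -> Q s) -> forall s, Q s.
Proof.
move=> h s; have [n] := ubnP #|[set u | (s < u)%O]|.
elim: n s => // n IH s sn; apply: h => w sw; apply: IH.
exact: leq_trans (card_above_lt sw) sn.
Qed.

(** The defining recursion says that the Moebius transform of the left-hand
    side, as a function of [s], vanishes below the top; so does that of the
    constant 1, and both functions are 1 at the top. *)
Lemma chow_above_total s :
  \sum_(t | (s <= t)%O) H t - \sum_(t | (s <= t)%O) gs s t * H t = 1.
Proof.
(* The Moebius transform of G vanishes below the top, by the defining recursion. *)
pose G w := \sum_(t | (w <= t)%O) H t - \sum_(t | (w <= t)%O) gs w t * H t.
rewrite -/(G s); elim/up_ind: s => s IH.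
have [->|s1] := eqVneq s \top%O.
  have e1 (f : T -> {poly R}) : \sum_(t | (\top <= t)%O) f t = f \top%O.
    by rewrite (big_pred1 \top%O) // => t; rewrite le1x.
  by rewrite /G !e1 subnn /gsum big_ord0 mul0r subr0 chow_aboveE eqxx.
have st : (s < \top)%O by rewrite ltx1.
have mu0 : \sum_(w | (s <= w)%O) mu s w *: G w = 0.
  rewrite /G; under eq_bigr do rewrite scalerBr !scaler_sumr.
  rewrite big_split sumrN /=.
  rewrite (exchange_big_dep (fun t => (s <= t)%O)) /=; last first.
    by move=> w t; exact: le_trans.
  rewrite [X in _ - X](exchange_big_dep (fun t => (s <= t)%O)) /=; last first.
    by move=> w t; exact: le_trans.
  rewrite -sumrB (bigD1 s) //=.
  have -> : \sum_(i | (s <= i)%O && (i <= s)%O) mu s i *: H s = H s.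
    rewrite (big_pred1 s) => [|i]; last by rewrite andbC -eq_le.
    by rewrite mobiusE eqxx scale1r.
  rewrite [X in _ - X](_ : _ = 0) ?subr0; last first.
    rewrite (big_pred1 s) => [|i]; last by rewrite andbC -eq_le.
    by rewrite subnn /gsum big_ord0 mul0r scaler0.
  rewrite chow_aboveE (negPf s1).
  rewrite (eq_bigl (fun t => (s < t)%O)); last by move=> t; rewrite lt_def andbC.
  apply/eqP; rewrite addr_eq0 -sumrN; apply/eqP/eq_bigr => t lt.
  rewrite red_charpolyE // mulr_suml -scaler_suml -rmorph_sum /= mobius_sum0 //.
  by rewrite rmorph0 scale0r sub0r opprK; apply: eq_bigr => w _; rewrite scalerAl.
have mu1 : \sum_(w | (s <= w)%O) mu s w *: (1 : {poly R}) = 0.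
  rewrite -scaler_suml -rmorph_sum /=.
  have -> : \sum_(w : T | (s <= w)%O) mobius s w = 0.
    by rewrite -[RHS](mobius_sum0 st); apply: eq_bigl => w; rewrite lex1 andbT.
  by rewrite rmorph0 scale0r.
have := etrans mu0 (esym mu1); rewrite (bigD1 s) //= [RHS](bigD1 s) //=.
rewrite mobiusE eqxx !scale1r => /(canRL (addrK _)) ->; rewrite -addrA.
rewrite [X in _ + (_ - X)](eq_bigr (fun w => mu s w *: (1 : {poly R}))) ?subrr ?addr0 // => w /andP[sw ws].
by rewrite IH // lt_def ws.
Qed.

Lemma chow_above_qsum s : H s = 1 +
  \sum_(w | (s < w)%O) qsum 'X (rank w - rank s) * H w.
Proof.
rewrite -{1}(chow_above_total s) -sumrB.
rewrite (bigD1 s) //= subnn {1}/gsum big_ord0 mul0r subr0.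
rewrite (eq_bigl (fun t => (s < t)%O)); last by move=> t; rewrite lt_def andbC.
rewrite -addrA -big_split big1 ?addr0 // => t /rank_lt; rewrite -subn_gt0.
case: (rank t - rank s)%N => // n _.
by rewrite /gsum /qsum big_ord_recl big_add1 big_mkord expr0 mulrDl mul1r /=; ring.
Qed.

Lemma chow_above_ge0 s i : 0 <= (H s)`_i.
Proof.
elim/up_ind: s i => s IH i; rewrite chow_above_qsum coefD addr_ge0 //.
  by rewrite coef1 ler0n.
rewrite coef_sum sumr_ge0 // => w sw; rewrite coefM sumr_ge0 // => j _.
rewrite mulr_ge0 ?IH // /qsum coef_sum sumr_ge0 // => m _.
by rewrite coefXn ler0n.
Qed.

Lemma aug_chow_ge0 i : 0 <= (aug_chow R T)`_i.
Proof.
rewrite /aug_chow coef_sum sumr_ge0 // => w _; rewrite coefXnM.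
by case: ifP => // _; exact: chow_above_ge0.
Qed.

End ChowRecursion.

Section Transpose.
Context {F : comNzRingType} {d : Order.disp_t} {T : finTBPOrderType d}.

(** Solving from the bottom or from the top pairs the same inverse of
    1 - k with the same two vectors.  It expresses the Chow polynomial of the
    dual of a poset by a recursion that runs upwards in the poset itself, where
    ranks determine the numbers of elements. *)
Lemma transpose_solution (k : T -> T -> F) (c : F) (f g : T -> F) :
  (forall t, f t = 1 + \sum_(s | (s < t)%O) k s t * f s) ->
  (forall s, g s = c * (s == \top%O)%:R + \sum_(t | (s < t)%O) k s t * g t) ->
  c * f \top%O = \sum_s g s.
Proof.
move=> fE gE.
have -> : c * f \top%O = \sum_s f s * (c * (s == \top%O)%:R).
  rewrite (bigD1 \top%O) //= eqxx mulr1 big1 ?addr0 1?mulrC // => s /negPf ->.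
  by rewrite !mulr0.
have e1 : \sum_s f s * (c * (s == \top%O)%:R) =
    \sum_s f s * g s - \sum_s \sum_(t | (s < t)%O) f s * (k s t * g t).
  rewrite -sumrB; apply: eq_bigr => s _.
  by rewrite [in RHS]gE mulrDr -mulr_sumr addrK.
have e2 : \sum_s g s =
    \sum_s f s * g s - \sum_t \sum_(s | (s < t)%O) f s * (k s t * g t).
  rewrite -sumrB; apply: eq_bigr => t _.
  rewrite [in RHS]fE mulrDl mul1r mulr_suml.
  rewrite [X in _ - X](eq_bigr (fun s => k s t * f s * g t)); first by rewrite addrK.
  by move=> s _; ring.
rewrite e1 e2; congr (_ - _).
by rewrite (exchange_big_dep xpredT).
Qed.

End Transpose.

(** * Chain sums and the h-polynomial *)

Section ChainSums.
Context {F : comNzRingType} {d : Order.disp_t} {T : finTBPOrderType d}.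
Implicit Types (s t w : T) (A : {set T}).
Local Notation rtop := (rank (\top%O : T)).

Definition chain_above s A : bool := is_chain A && [forall a in A, (s < a)%O].

Lemma chain_aboveP s A :
  reflect (is_chain A /\ {in A, forall a, (s < a)%O}) (chain_above s A).
Proof. by apply: (iffP andP) => -[cA /forall_inP]. Qed.

Lemma chain_above0 s : chain_above s set0.
Proof.
by apply/chain_aboveP; split=> [|a]; [apply/is_chainP => a|]; rewrite inE.
Qed.

Lemma sub_chain (A B : {set T}) : A \subset B -> is_chain B -> is_chain A.
Proof.
move=> /subsetP sAB /is_chainP cB; apply/is_chainP => a b aA bA.
by apply: cB; exact: sAB.
Qed.

Lemma chainU s A : chain_above s A -> is_chain (s |: A).
Proof.
case/chain_aboveP => /is_chainP cA sA; apply/is_chainP => a b; rewrite !inE.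
case/predU1P => [->|aA] /predU1P[->|bA].
- exact: comparablexx.
- exact/le_comparable/ltW/sA.
- by rewrite comparable_sym; exact/le_comparable/ltW/sA.
- exact: cA.
Qed.

Lemma chain_above_leq s A : chain_above s A -> (#|A| <= rtop - rank s)%N.
Proof.
case/chain_aboveP => /is_chainP cA sA.
have [B [/is_chainP cB Bs eB]] := rankP s.
have dis : [disjoint B & A].
  apply/pred0P => a /=; apply/negP => /andP[/Bs as_ /sA].
  by rewrite (le_gtF as_).
have : is_chain (B :|: A).
  apply/is_chainP => a b; rewrite !inE => /orP[aB|aA] /orP[bB|bA].
  - exact: cB.
  - by apply/le_comparable/ltW/(le_lt_trans (Bs _ aB))/sA.
  - by rewrite comparable_sym; apply/le_comparable/ltW/(le_lt_trans (Bs _ bB))/sA.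
  - exact: cA.
move/(leq_rank (s := \top%O)) => /(_ (fun x _ => lex1 x)).
by move: dis; rewrite -leq_card_setU => /eqP ->; rewrite eB; lia.
Qed.

Variables (u v : F).

Definition chain_sum s : F :=
  \sum_(A | chain_above s A) u ^+ #|A| * v ^+ (rtop - rank s - #|A|).

Definition least A : T := odflt \bot%O [pick w in A | [forall a in A, (w <= a)%O]].

Lemma leastP A : is_chain A -> A != set0 ->
  least A \in A /\ {in A, forall a, (least A <= a)%O}.
Proof.
move=> /is_chainP cA /set0Pn[a0 a0A]; rewrite /least; case: pickP => [w /andP[wA /forall_inP]|no] //.
exfalso; case: (@arg_minnP _ a0 (fun w => w \in A) (fun w => rank w)) => // w wA wmin.
have := no w; rewrite wA /= => /forall_inP[] a aA.
case: (comparable_ltgtP (cA _ _ wA aA)) => // /rank_lt.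
by rewrite ltnNge wmin.
Qed.

Lemma least_eq A w : w \in A -> {in A, forall a, (w <= a)%O} -> least A = w.
Proof.
move=> wA wle; rewrite /least; case: pickP => [w' /andP[w'A /forall_inP w'le]|no] /=.
  by apply/eqP; rewrite eq_le wle ?w'le.
by have := no w; rewrite wA /= => /forall_inP[].
Qed.

(** Split a nonempty chain into its least element and the rest. *)
Lemma chain_sum_rec s : chain_sum s = v ^+ (rtop - rank s) +
  \sum_(w | (s < w)%O) u * v ^+ (rank w - rank s).-1 * chain_sum w.
Proof.
rewrite {1}/chain_sum (bigD1 set0) ?chain_above0 //= cards0 expr0 mul1r subn0.
congr (_ + _); rewrite (partition_big least (fun w => (s < w)%O)) /=; last first.
  move=> A /andP[/chain_aboveP[cA sA] A0].
  by have [lA _] := leastP cA A0; exact: sA.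
apply: eq_bigr => w sw; rewrite /chain_sum mulr_sumr.
rewrite (reindex_onto (fun A => w |: A) (fun A => A :\ w)) /=; last first.
  move=> A /andP[/andP[/chain_aboveP[cA _] A0] /eqP <-].
  by rewrite setD1K //; have [] := leastP cA A0.
apply: eq_big => [A|A].
  apply/idP/idP.
    case/andP => /andP[/andP[/chain_aboveP[cA sA] _] /eqP lA] /eqP eA.
    have wA : w \notin A by rewrite -eA !inE eqxx.
    have [|_ lle] := leastP cA; first by apply/set0Pn; exists w; rewrite !inE eqxx.
    apply/chain_aboveP; split; first by apply: sub_chain cA; exact: subsetUr.
    move=> a aA; rewrite lt_def; apply/andP; split.
      by apply: contraNneq wA => <-.
    by rewrite -lA lle // !inE aA orbT.
  move=> wA; have [cA wlt] := chain_aboveP _ _ wA.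
  have nwA : w \notin A by apply/negP => /wlt; rewrite ltxx.
  rewrite setU1K // eqxx andbT; apply/andP; split; last first.
    apply/eqP/least_eq; rewrite ?inE ?eqxx // => a; rewrite !inE.
    by case/predU1P => [->//|/wlt/ltW].
  apply/andP; split; last by apply/set0Pn; exists w; rewrite !inE eqxx.
  apply/chain_aboveP; split; first exact: chainU.
  by move=> a; rewrite !inE => /predU1P[->//|/wlt]; exact: lt_trans.
case/andP => /andP[/andP[/chain_aboveP[cA sA] _] /eqP lA] /eqP eA.
have nwA : w \notin A by rewrite -eA !inE eqxx.
have wA : chain_above w A.
  have [|_ lle] := leastP cA; first by apply/set0Pn; exists w; rewrite !inE eqxx.
  apply/chain_aboveP; split; first by apply: sub_chain cA; exact: subsetUr.
  move=> a aA; rewrite lt_def; apply/andP; split.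
    by apply: contraNneq nwA => <-.
  by rewrite -lA lle // !inE aA orbT.
have := chain_above_leq wA; have := rank_lt sw => rsw leA.
have wtop : (rank w <= rtop)%N.
  by have := lex1 w; rewrite le_eqVlt => /predU1P[->//|/rank_lt/ltnW].
rewrite cardsU1 nwA exprD expr1.
have -> : (rtop - rank s - (1 + #|A|) = (rank w - rank s).-1 + (rtop - rank w - #|A|))%N by lia.
by rewrite exprD mulrACA.
Qed.

(** Adding or removing the bottom element pairs up the chains, and the two
    weights of a pair add up since u + v = 1. *)
Lemma chain_sum_bot : u + v = 1 ->
  \sum_(A : {set T} | is_chain A) u ^+ #|A| * v ^+ (rtop.+1 - #|A|) = chain_sum \bot%O.
Proof.
move=> uv; rewrite (bigID (fun A : {set T} => \bot%O \in A)) /=.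
rewrite (reindex_onto (fun A => \bot%O |: A) (fun A => A :\ \bot%O)) /=; last first.
  by move=> A /andP[_ bA]; rewrite setD1K.
have above A : is_chain A && (\bot%O \notin A) = chain_above \bot%O A.
  apply/andP/chain_aboveP => -[cA h]; split=> //.
    by move=> a aA; rewrite lt0x; apply: contraNneq h => <-.
  by apply/negP => /h; rewrite ltxx.
rewrite (eq_bigl _ _ above).
rewrite [X in X + _](eq_bigl (chain_above \bot%O)); last first.
  move=> A; rewrite -above; apply/idP/idP.
    case/andP=> /andP[cA _] /eqP eA; rewrite -eA; apply/andP; split.
      by apply: sub_chain cA; rewrite eA subsetUr.
    by rewrite !inE eqxx.
  move=> h; rewrite chainU -?above // !inE eqxx /=.
  by case/andP: h => _ h; rewrite setU1K.
rewrite -big_split /chain_sum; apply: eq_bigr => A hA.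
have leA := chain_above_leq hA; rewrite rank0 subn0 in leA *.
have nA : \bot%O \notin A by move: hA; rewrite -above => /andP[].
rewrite cardsU1 nA add1n subSS subSn // !exprS.
set X := u ^+ _; set Y := v ^+ _; rewrite -[RHS]mul1r -uv. rewrite /=; ring.
Qed.

End ChainSums.

Section HPolynomial.
Context (R : realType) {d : Order.disp_t} (T : finTBPOrderType d).

Lemma h_polynomialE :
  h_polynomial R (order_complex T) = @chain_sum {poly R} d T 'X (1 - 'X) \bot%O.
Proof.
rewrite /h_polynomial; set n := (\max_(A in _) _)%N.
have nE : n = (rank (\top%O : T)).+1.
  apply/eqP; rewrite eqn_leq; apply/andP; split.
    by apply/bigmax_leqP => A; rewrite inE => cA; apply: leq_rank => // x _; exact: lex1.
  have [A [cA _ <-]] := rankP (\top%O : T).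
  by rewrite /n; apply: (@leq_bigmax_cond _ _ (fun A : {set T} => #|A|)); rewrite inE.
rewrite -chain_sum_bot; last by rewrite addrC subrK.
rewrite (partition_big (fun A : {set T} => inord #|A| : 'I_n.+1) xpredT) //=.
apply: eq_bigr => i _; rewrite scaler_nat.
have lt (A : {set T}) : is_chain A -> (#|A| < n.+1)%N.
  by move=> cA; rewrite nE ltnS; exact: (leq_rank cA (fun x _ => lex1 x)).
rewrite (eq_bigr (fun _ => 'X^i * (1 - 'X) ^+ (n - i))); last first.
  by move=> A /andP[cA /eqP <-]; rewrite inordK ?lt // nE.
rewrite sumr_const; congr (_ *+ _); apply: eq_card => A; rewrite !inE unfold_in.
case: (boolP (is_chain A)) => //= cA.
by rewrite -val_eqE /= inordK // lt.
Qed.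

End HPolynomial.

(** * Counting elements through increasing chains *)

Section GradedPosets.
Context {d : Order.disp_t} {T : finTBPOrderType d}.
Hypothesis gradedT : graded T.
Implicit Types s t u w : T.
Local Notation rtop := (rank (\top%O : T)).

Lemma rank_covers s t : covers s t -> rank t = (rank s).+1.
Proof. by have [rk rkP] := gradedT; rewrite -!(rank_functionE rkP); apply: rkP.2. Qed.

Lemma rank_path s c : path covers s c -> rank (last s c) = (rank s + size c)%N.
Proof.
elim: c s => [|t c IH] s /=; first by rewrite addn0.
by case/andP => /rank_covers st /IH ->; rewrite st addSnnS.
Qed.

Lemma rank_le_top s : (rank s <= rtop)%N.
Proof. by have := lex1 s; rewrite le_eqVlt => /predU1P[->//|/rank_lt/ltnW]. Qed.

Lemma rank_top_eq s : (rank s == rtop) = (s == \top%O).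
Proof.
apply/eqP/eqP => [e|->//]; have := lex1 s; rewrite le_eqVlt => /predU1P[//|/rank_lt].
by rewrite e ltnn.
Qed.

Lemma rank_bot_eq s : (rank s == 0%N) = (s == \bot%O).
Proof.
apply/eqP/eqP => [e|->]; last exact: rank0.
by have := le0x s; rewrite le_eqVlt => /predU1P[//|/rank_lt]; rewrite e.
Qed.

Lemma path_le s c : path covers s c -> (s <= last s c)%O.
Proof.
elim: c s => [|t c IH] s //= /andP[/covers_lt/ltW st /IH]; exact: le_trans.
Qed.

End GradedPosets.

Section SortedIndex.
Context {dL : Order.disp_t} {L : orderType dL}.

(** An ascent can thus be read off the index of the second label and the number
    of labels below the first one. *)
Lemma le_index_sorted (l : seq L) a b : sorted <%O l -> b \in l ->
  (a <= b)%O = (size [seq y <- l | (y < a)%O] <= index b l)%N.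
Proof.
elim: l => //= x l IH sl; rewrite inE => bl.
have /allP xl : all (fun y => x < y)%O l by exact: order_path_min lt_trans sl.
have emp : (a <= x)%O -> [seq y <- l | (y < a)%O] = [::].
  move=> ax; apply/eqP; rewrite -size_eq0 size_filter eqn0Ngt -has_count.
  apply/hasPn => y /xl xy; rewrite -leNgt; exact: le_trans ax (ltW xy).
case: (eqVneq x b) bl => [<-|xb] /= bl; case: ltP => //= ax.
- by rewrite emp.
- by rewrite ltnS IH ?(path_sorted sl).
- rewrite emp //=; apply: (le_trans ax); apply: ltW; exact: xl.
Qed.

End SortedIndex.

Section ELCounting.
Context {d : Order.disp_t} {T : finTBPOrderType d}.
Context {dL : Order.disp_t} {L : orderType dL} (lam : T -> T -> L).
Hypothesis gradedT : graded T.
Hypothesis ELlam : EL_labeling lam.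
Hypothesis unif : rank_uniform lam.
Hypothesis mono : monotonic lam.
Implicit Types s t u w : T.
Local Notation rtop := (rank (\top%O : T)).
Local Notation Ind := (Ind lam).
Local Notation des := (des lam).
Local Notation width := (width lam).
Local Notation labels_above := (labels_above lam).

Lemma exists_max_chain s t : (s <= t)%O -> exists c, path covers s c /\ last s c = t.
Proof.
by move=> /ELlam[c [/andP[pc /eqP lc] _ _ _]]; exists c.
Qed.

Lemma exists_between s t m : (s <= t)%O -> (rank s <= m <= rank t)%N ->
  exists w, [/\ (s <= w)%O, (w <= t)%O & rank w = m].
Proof.
move=> /exists_max_chain[c [pc <-]] {t}; elim: c s pc => [|t c IH] s /= pc sm.
  by exists s; split=> //; lia.
case/andP: pc => st pc; case: (ltngtP (rank s) m) => [sm'|ms|sm'].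
- have [|w [tw wl rw]] := IH t pc; first by rewrite (rank_covers gradedT st); lia.
  by exists w; split=> //; exact: le_trans (ltW (covers_lt st)) tw.
- by lia.
- by exists s; split=> //; apply: (@path_le _ _ s (t :: c)); rewrite /= st.
Qed.

(** A representative of each rank; by rank-uniformity it does not
    matter which one is used to define [ell], [om] and [ds]. *)
Definition rep (k : nat) : T := odflt \bot%O [pick s | rank s == k].

Lemma rank_rep k : (k <= rtop)%N -> rank (rep k) = k.
Proof.
move=> kr; rewrite /rep; case: pickP => [s /eqP//|no].
have [|w [_ _ /eqP]] := @exists_between \bot%O \top%O k (le0x _); first by rewrite rank0.
by rewrite no.
Qed.

Lemma labels_aboveP s a :
  reflect (exists2 t, covers s t & a = lam s t) (a \in labels_above s).
Proof.
rewrite /labels_above mem_sort mem_undup; apply: (iffP mapP) => -[t].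
  by rewrite mem_filter => /andP[st _] ->; exists t.
by move=> st ->; exists t => //; rewrite mem_filter st mem_enum.
Qed.

Lemma labels_above_sorted s : sorted <%O (labels_above s).
Proof. by rewrite sort_lt_sorted undup_uniq. Qed.

Lemma Ind_lt s t : covers s t -> ((Ind s t).-1 < size (labels_above s))%N.
Proof. by move=> st; rewrite index_mem; apply/labels_aboveP; exists t. Qed.

Lemma Ind_surj s i : (i < size (labels_above s))%N ->
  exists2 t, covers s t & Ind s t = i.+1.
Proof.
move=> lti; have [t0] := labels_aboveP _ _ (mem_nth (lam s s) lti).
move=> st e; exists t0 => //; rewrite /Ind -e index_uniq //.
by rewrite sort_uniq undup_uniq.
Qed.

Lemma width_gt0 s i : (0 < width s i.+1)%N = (i < size (labels_above s))%N.
Proof.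
apply/card_gt0P/idP => [[t]|/Ind_surj[t st e]].
  by rewrite inE => /andP[/Ind_lt lti /eqP e]; rewrite e in lti.
by exists t; rewrite inE st e eqxx.
Qed.

Definition ell k := size (labels_above (rep k)).
Definition om k j := width (rep k) j.+1.
Definition ds k i : nat :=
  if [pick t | covers (rep k) t && (Ind (rep k) t == i.+1)] is Some t
  then des (rep k) t else 0%N.

Lemma ellE s : ell (rank s) = size (labels_above s).
Proof.
have rs := rank_rep (rank_le_top s).
have e i : (i < ell (rank s))%N = (i < size (labels_above s))%N.
  by rewrite /ell -!width_gt0 (unif.1 _ _ i.+1 rs).
have := e (ell (rank s)); have := e (size (labels_above s)).
by rewrite !ltnn; lia.
Qed.

Lemma omE s j : om (rank s) j = width s j.+1.
Proof. by rewrite /om (unif.1 _ _ j.+1 (rank_rep (rank_le_top s))). Qed.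

Lemma dsE s t : covers s t -> ds (rank s) (Ind s t).-1 = des s t.
Proof.
move=> st; have rs := rank_rep (rank_le_top s); rewrite /ds.
case: pickP => [t' /andP[st' /eqP e]|no]; first exact: unif.2.
have [|t' st' e] := @Ind_surj (rep (rank s)) (Ind s t).-1.
  by rewrite -/(ell _) ellE Ind_lt.
by have := no t'; rewrite st' e eqxx.
Qed.

Lemma ds_mono k i j : (i <= j < ell k)%N -> (ds k i <= ds k j)%N.
Proof.
case/andP=> ij jk; rewrite /ds.
case: pickP => [t /andP[st /eqP et]|] //; case: pickP => [t' /andP[st' /eqP et']|no].
  by apply: mono => //; rewrite et et'.
have [t' st' e] := Ind_surj jk; by have := no t'; rewrite st' e eqxx.
Qed.

Lemma ascentE s t u : covers s t -> covers t u ->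
  (lam s t <= lam t u)%O = (ds (rank s) (Ind s t).-1 <= (Ind t u).-1)%N.
Proof.
move=> st tu; rewrite dsE // /des /Ind /=; apply: le_index_sorted.
  exact: labels_above_sorted.
by apply/labels_aboveP; exists u.
Qed.

Lemma sum_covers (F : comNzRingType) s (Q : pred nat) (f : nat -> F) :
  \sum_(t | covers s t && Q (Ind s t).-1) f (Ind s t).-1 =
  wsum (ell (rank s)) (om (rank s)) Q f.
Proof.
rewrite /wsum.
under [RHS]eq_bigr do rewrite omE mulr_natl -sumr_const.
rewrite (exchange_big_dep (fun t => covers s t && Q (Ind s t).-1)) /=; last first.
  by move=> j t Qj; rewrite !inE => /andP[-> /eqP /(congr1 predn) /= ->].
apply: eq_bigr => t /andP[st Qt].
have lt : ((Ind s t).-1 < ell (rank s))%N by rewrite ellE Ind_lt.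
rewrite (big_pred1 (Ordinal lt)) // => j /=; rewrite !inE st /= -val_eqE /=.
rewrite /Defs.Ind /= eqSS [RHS]eq_sym; case: eqP => [<-|_]; last by rewrite andbF.
by rewrite andbT; exact: Qt.
Qed.

(** Boolean, so that the elements [w] can be counted; [incP] gives the meaning in
    terms of weakly increasing chains. *)
Fixpoint inc n s t w : bool :=
  if n is n'.+1 then [exists u, [&& covers t u, (lam s t <= lam t u)%O & inc n' t u w]]
  else w == t.

Lemma incP n s t w : covers s t ->
  reflect (exists c, [/\ size c = n, max_chain s w (t :: c) &
                         sorted <=%O (labels lam s (t :: c))]) (inc n s t w).
Proof.
elim: n s t => [|n IH] s t st /=.
  apply: (iffP eqP) => [->|[[|? ?] [//= _ /andP[_ /eqP /= <-]]] //].
  by exists [::]; rewrite /max_chain /= st eqxx.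
apply: (iffP existsP) => [[u /and3P[tu le /(IH _ _ tu)[c [sc /andP[pc lc] srt]]]]|].
  exists (u :: c); rewrite /= sc; split=> //.
    by rewrite /max_chain; move: pc lc => /= -> ->; rewrite st.
  by move: srt; rewrite /labels /= le.
case=> -[|u c] [] //= [sc] /andP[/= /and3P[_ tu pc] lc] /andP[le srt].
by exists u; rewrite tu le; apply/(IH _ _ tu); exists c; split=> //; rewrite /max_chain /= tu pc.
Qed.

Lemma inc_inj n n' s t t' w : covers s t -> covers s t' ->
  inc n s t w -> inc n' s t' w -> t = t'.
Proof.
move=> st st' /(incP _ _ st)[c [_ mc sc]] /(incP _ _ st')[c' [_ mc' sc']].
have sw : (s <= w)%O by case/andP: mc => /path_le; move=> + /eqP <-.
by have [c0 [_ _ uniq _]] := ELlam sw; move: (uniq _ mc sc) (uniq _ mc' sc') => <- [].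
Qed.

Lemma inc_exists s w n : (s < w)%O -> rank w = (rank s + n.+1)%N ->
  exists2 t, covers s t & inc n s t w.
Proof.
move=> sw rw; have [[|t c] [mc sc _ _]] := ELlam (ltW sw).
  by case/andP: mc => _ /eqP /= e; rewrite e ltxx in sw.
have /andP[/= /andP[st pc] /eqP lc] := mc; exists t => //; apply/incP => //.
exists c; split=> //; have := rank_path gradedT pc.
by rewrite lc rw (rank_covers gradedT st); lia.
Qed.

Lemma inc_lt n s t w : covers s t -> inc n s t w ->
  (s < w)%O /\ rank w = (rank s + n.+1)%N.
Proof.
move=> st /(incP _ _ st)[c [<- /andP[pc /eqP <-] _]].
split; last exact: (rank_path gradedT pc).
by case/andP: pc => _ /= /path_le; apply: lt_le_trans; exact: covers_lt.
Qed.

Lemma card_bigcup_inc n t (Q : pred T) :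
  #|[set w | [exists u, [&& covers t u, Q u & inc n t u w]]]| =
  (\sum_(u | covers t u && Q u) #|[set w | inc n t u w]|)%N.
Proof.
under [RHS]eq_bigr do rewrite -sum1dep_card.
rewrite -sum1dep_card (exchange_big_dep (fun w => [exists u, [&& covers t u, Q u & inc n t u w]])) /=.
  apply: eq_bigr => w /existsP[u /and3P[tu Qu iu]].
  rewrite (big_pred1 u) // => u' /=; apply/andP/eqP => [[/andP[tu' _] iu']|->].
    exact: inc_inj iu' iu.
  by rewrite tu Qu.
by move=> u w /andP[tu Qu] iu; apply/existsP; exists u; rewrite tu Qu.
Qed.

Lemma card_inc (F : comNzRingType) n s t : covers s t ->
  #|[set w | inc n s t w]|%:R = asc ell om ds (rank s) n (Ind s t).-1 :> F.
Proof.
elim: n s t => [|n IH] s t st /=.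
  by rewrite (_ : [set w | w == t] = [set t]) ?cards1 //; apply/setP => w; rewrite !inE.
rewrite (card_bigcup_inc n t (fun u => lam s t <= lam t u)%O) natr_sum.
rewrite /ascend -(rank_covers gradedT st) -sum_covers.
by apply: eq_big => [u|u /andP[tu _]]; [case: (boolP (covers t u)) => //= tu; exact: ascentE|exact: IH].
Qed.

(** Each such element is reached from [s] by exactly one weakly increasing
    chain. *)
Lemma card_rank_above (F : comNzRingType) n s :
  #|[set w | (s < w)%O && (rank w == (rank s + n.+1)%N)]|%:R =
  lsum ell om (rank s) (asc ell om ds (rank s) n) :> F.
Proof.
have -> : [set w | (s < w)%O && (rank w == (rank s + n.+1)%N)] =
    [set w | [exists u, [&& covers s u, predT u & inc n s u w]]].
  apply/setP => w; rewrite !inE; apply/andP/existsP.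
    by case=> sw /eqP /(inc_exists sw)[t st it]; exists t; rewrite st it.
  by case=> t /and3P[st _ /(inc_lt st)[-> /eqP ->]].
rewrite card_bigcup_inc natr_sum /lsum -sum_covers.
apply: eq_big => // u /andP[su _]; exact: card_inc.
Qed.

End ELCounting.

(** * Ranks and sums in a rank selection *)

Section SelectedCount.
Variable S : pred nat.
Local Notation nsel := (nsel S).

Lemma nselD k a b : nsel k (a + b) = (nsel k a + nsel (k + a) b)%N.
Proof.
elim: a k => [|a IH] k /=; first by rewrite addn0.
by rewrite IH addnA addSnnS.
Qed.

Lemma nsel_eq0 k n : (forall j, (k < j <= k + n)%N -> ~~ S j) -> nsel k n = 0%N.
Proof.
elim: n k => //= n IH k h; rewrite IH => [|j jn]; last by apply: h; lia.
by rewrite (negPf (h _ _)) //; lia.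
Qed.

End SelectedCount.

Section RankSelection.
Context {d : Order.disp_t} {P : finTBPOrderType d}.
Context {dL : Order.disp_t} {L : orderType dL} (lam : P -> P -> L).
Hypothesis gradedP : graded P.
Hypothesis ELlam : EL_labeling lam.
Variable S : pred nat.
Local Notation r := (rank (\top%O : P)).
Hypothesis S_sub : forall i : nat, i \in S -> (1 <= i < r)%N.
Local Notation Q := (rank_sel P S).
Implicit Types x y : Q.

(** The rank in the selection of an element of rank [k].  The top rank is not in
    [S] but is always selected, hence the second summand. *)
Definition sel_rank (k : nat) : nat := (nsel S 0 k + ((0 < k) && (k == r)))%N.

Lemma lt_rank_sel x y : (x < y)%O = (val x < val y)%O.
Proof. by rewrite Order.SubPreorderTheory.lt_val. Qed.

(** Between comparable elements every intermediate rank of [P] is attained, so a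
    covering pair of the rank selection skips no selected rank. *)
Lemma covers_rank_sel x y :
  covers x y -> sel_rank (rank (val y)) = (sel_rank (rank (val x))).+1.
Proof.
case/andP; rewrite lt_rank_sel => xy /forallP no.
have lt := rank_lt xy; have yr := rank_le_top (val y).
have nS j : (rank (val x) < j < rank (val y))%N -> ~~ S j.
  move=> /andP[xj jy]; apply/negP => Sj.
  have [|w [xw wy rw]] := exists_between gradedP ELlam (m := j) (ltW xy).
    by rewrite (ltnW xj) (ltnW jy).
  have Qw : in_rank_sel S w by rewrite /in_rank_sel rw [_ \in _]Sj.
  have xw' : (val x < w)%O.
    by rewrite lt_neqAle xw andbT; apply: contraTneq xj => ->; rewrite rw ltnn.
  have wy' : (w < val y)%O.
    by rewrite lt_neqAle wy andbT; apply: contraTneq jy => <-; rewrite rw ltnn.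
  by have := no (exist _ w Qw); rewrite !lt_rank_sel /= xw' wy'.
have [n en] : exists n, rank (val y) = (rank (val x) + n.+1)%N.
  by exists (rank (val y) - rank (val x)).-1; lia.
have xr : (rank (val x) == r) = false by apply/negP => /eqP; lia.
have e : nsel S 0 (rank (val y)) = (nsel S 0 (rank (val x)) + S (rank (val y)))%N.
  rewrite en nselD add0n -[n.+1]addn1 nselD (nsel_eq0 (n := n)).
    by rewrite add0n addn1 addnS; congr (_ + _)%N; exact: addn0.
  by move=> j jn; apply: nS; lia.
rewrite /sel_rank xr andbF addn0 e.
have Qy : in_rank_sel S (val y) by exact: (valP y).
case/or3P: Qy => [Sy|/eqP|/eqP]; last 2 first.
- by lia.
- move=> ->; rewrite eqxx; case Sr : (S r); last by lia.
  by have := S_sub Sr; rewrite ltnn andbF.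
have Sy' : S (rank (val y)) by [].
by rewrite Sy'; have := S_sub Sy; lia.
Qed.

Lemma rank_rank_sel x : rank x = sel_rank (rank (val x)).
Proof.
rewrite -[LHS](rank_functionE (rk := fun x : Q => sel_rank (rank (val x)))) //.
split; last exact: covers_rank_sel.
by rewrite /= rank0 /sel_rank /=.
Qed.

Lemma sum_rank_sel (F : nmodType) (A : pred P) (f : P -> F) :
  \sum_(y : Q | A (val y)) f (val y) = \sum_(w | A w && in_rank_sel S w) f w.
Proof.
rewrite [RHS](reindex_onto (val : Q -> P) (insubd (\bot%O : Q))) /=; last first.
  by move=> w /andP[_ Qw]; rewrite insubdK.
by apply: eq_bigl => y; rewrite (valP y) valKd eqxx !andbT.
Qed.

End RankSelection.

Section RankSelectionSums.
Context {d : Order.disp_t} {P : finTBPOrderType d}.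
Context {dL : Order.disp_t} {L : orderType dL} (lam : P -> P -> L).
Hypothesis gradedP : graded P.
Hypothesis ELlam : EL_labeling lam.
Hypothesis unif : rank_uniform lam.
Variable S : pred nat.
Local Notation r := (rank (\top%O : P)).
Local Notation Q := (rank_sel P S).
Local Notation level_sum k n := (lsum (ell lam) (om lam) k (asc (ell lam) (om lam) (ds lam) k n)).

Lemma level_sum_top (F : comNzRingType) k n : (k + n.+1)%N = r -> level_sum k n = 1 :> F.
Proof.
move=> kn; have kr : (k <= r)%N by lia.
rewrite -(rank_rep gradedP ELlam kr) -(card_rank_above gradedP ELlam unif).
rewrite (_ : [set w | _] = [set \top%O]) ?cards1 //; apply/setP => w; rewrite !inE.
rewrite (rank_rep gradedP ELlam kr) kn rank_top_eq andbC.
case: eqP => //= ->; rewrite ltx1; apply/eqP => e.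
have := rank_rep gradedP ELlam kr; rewrite e => rk.
by rewrite rk in kn; lia.
Qed.

(** Group the elements by rank; the only one of top rank is the top. *)
Lemma sum_above_rank_sel (F : comNzRingType) (x : Q) n (f : nat -> F) :
  (rank (val x) + n.+1)%N = r ->
  \sum_(y | (x < y)%O) f (rank (val y)) = f r +
    \sum_(j < n | S ((rank (val x)).+1 + j)%N)
       f ((rank (val x)).+1 + j)%N * level_sum (rank (val x)) j.
Proof.
set k := rank (val x) => kn.
rewrite (eq_bigl (fun y : Q => val x < val y)%O) => [|y]; last exact: lt_rank_sel.
rewrite (sum_rank_sel S (fun w => val x < w)%O (fun w => f (rank w))).
have xtop : (val x < \top)%O.
  by rewrite ltx1; apply/eqP => e; have kr : k = r; [rewrite /k e | lia].
rewrite (bigD1 (\top%O : P)) /=; last by rewrite xtop /in_rank_sel eqxx !orbT.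
congr (_ + _).
have e j : f (k.+1 + j)%N * level_sum k j =
    \sum_(w | (val x < w)%O && (rank w == (k.+1 + j)%N)) f (rank w).
  rewrite -(card_rank_above gradedP ELlam unif) addSnnS mulr_natr -sumr_const.
  rewrite [RHS](eq_bigr (fun _ => f (k + j.+1)%N)) => [|w /andP[_ /eqP ->]] //.
  by apply: eq_bigl => w; rewrite inE.
under [RHS]eq_bigr do rewrite e.
rewrite (exchange_big_dep (fun w => [&& (val x < w)%O, in_rank_sel S w & w != \top%O])) /=; last first.
  move=> j w Sj /andP[-> /eqP rw]; rewrite /in_rank_sel rw [_ \in _]Sj /=.
  by apply/eqP => e'; have := ltn_ord j; have rwr : rank w = r; [rewrite e' | lia].
rewrite (eq_bigl (fun w => [&& (val x < w)%O, in_rank_sel S w & w != \top%O])); last first.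
  by move=> w; rewrite andbA.
apply: eq_bigr => w /and3P[xw Qw wt].
have lt := rank_lt xw; have wr : (rank w < r)%N.
  by rewrite ltn_neqAle rank_le_top andbT rank_top_eq.
have Sw : S (rank w).
  by case/or3P: Qw => // /eqP; lia.
have jn : (rank w - k.+1 < n)%N by rewrite /k in lt *; lia.
rewrite (big_pred1 (Ordinal jn)) // => j /=; rewrite -val_eqE /= xw /=.
apply/andP/eqP => [[_ /eqP]|->]; first by lia.
by rewrite subnKC // Sw.
Qed.

End RankSelectionSums.

(** * Values of the polynomials as transfers *)

Section DualRank.
Context {d : Order.disp_t} {T : finTBPOrderType d}.
Hypothesis gradedT : graded T.

Lemma rank_dual (t : T) : rank (t : T^d) = (rank (\top%O : T) - rank t)%N.
Proof.
rewrite -(rank_functionE (T := T^d) (rk := fun t : T^d => (rank (\top%O : T) - rank (t : T))%N)) //.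
split; first by rewrite subnn.
move=> s t' /andP[lt /forallP no].
have /(rank_covers gradedT) e : covers (t' : T) (s : T).
  by apply/andP; split=> //; apply/forallP => w; have := no w; rewrite andbC.
by have := rank_le_top (s : T); rewrite e; lia.
Qed.

End DualRank.

Section Evaluation.
Context {R : realType} {d : Order.disp_t} {P : finTBPOrderType d}.
Context {dL : Order.disp_t} {L : orderType dL} (lam : P -> P -> L).
Hypothesis gradedP : graded P.
Hypothesis ELlam : EL_labeling lam.
Hypothesis unif : rank_uniform lam.
Variable S : pred nat.
Local Notation r := (rank (\top%O : P)).
Hypothesis S_sub : forall i : nat, i \in S -> (1 <= i < r)%N.
Local Notation Q := (rank_sel P S).
Local Notation C := (R[i]).
Local Notation rc := (real_complex R).
Local Notation sel_rank := (@sel_rank d P S).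
Local Notation level_sum k n := (lsum (ell lam) (om lam) k (asc (ell lam) (om lam) (ds lam) k n)).

Variable x : C.
Definition ev (p : {poly R}) : C := (map_poly rc p).[x].

Lemma ev1 : ev 1 = 1. Proof. by rewrite /ev rmorph1 hornerC. Qed.
Lemma evX : ev 'X = x. Proof. by rewrite /ev map_polyX hornerX. Qed.
Lemma evD p q : ev (p + q) = ev p + ev q.
Proof. by rewrite /ev rmorphD hornerD. Qed.
Lemma evB p q : ev (p - q) = ev p - ev q.
Proof. by rewrite /ev rmorphB hornerD hornerN. Qed.
Lemma evM p q : ev (p * q) = ev p * ev q.
Proof. by rewrite /ev rmorphM hornerM. Qed.
Lemma evXn p n : ev (p ^+ n) = ev p ^+ n.
Proof. by rewrite /ev rmorphXn horner_exp. Qed.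
Lemma ev_sum (I : Type) (s : seq I) (A : pred I) (f : I -> {poly R}) :
  ev (\sum_(i <- s | A i) f i) = \sum_(i <- s | A i) ev (f i).
Proof. by rewrite /ev rmorph_sum horner_sum. Qed.
Lemma ev_qsum c : ev (qsum 'X c) = qsum x c.
Proof. by rewrite /qsum ev_sum; apply: eq_bigr => i _; rewrite evXn evX. Qed.

Lemma sel_rank_sub k j : (k + j.+1 < r)%N ->
  (sel_rank (k.+1 + j) - sel_rank k)%N = nsel S k j.+1.
Proof.
move=> kj; rewrite /sel_rank addSnnS nselD add0n.
have -> : (k == r) = false by apply/eqP; lia.
have -> : (k + j.+1 == r)%N = false by apply/eqP; lia.
by rewrite !andbF !addn0 addKn.
Qed.

Lemma sel_rank_sub_top k n : (k + n.+1)%N = r ->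
  (sel_rank r - sel_rank k)%N = (nsel S k n).+1.
Proof.
move=> kn; rewrite /sel_rank eqxx.
have -> : (k == r) = false by apply/eqP; lia.
have Sr : S r = false by apply/negP => /S_sub; lia.
have e : nsel S 0 r = (nsel S 0 k + nsel S k n)%N.
  have e1 : nsel S (k + n) 1 = 0%N by rewrite /= -addnS kn Sr.
  by rewrite -kn nselD add0n -[n.+1]addn1 nselD e1 addn0.
by rewrite e andbF andbT -kn addnS ltn0Sn; lia.
Qed.

Lemma val_top_rank_sel (y : Q) : (rank (val y) == r) = (y == \top%O).
Proof. by rewrite rank_top_eq -val_eqE. Qed.

Lemma rank_lt_top (y : Q) : y != \top%O -> exists n, (rank (val y) + n.+1)%N = r.
Proof.
rewrite -val_top_rank_sel => yr; have := rank_le_top (val y) => le.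
by exists (r - rank (val y)).-1; lia.
Qed.

Lemma qsum_S_gsum c : qsum x c.+1 = x * gsum x c.
Proof.
rewrite /qsum /gsum big_add1 big_mkord mulr_sumr.
by apply: eq_bigr => i _; rewrite exprS.
Qed.

Local Notation headk al k n := (heads (ell lam) (om lam) (ds lam) S x al (1 + x) k n).

Lemma sum_weighted (y : Q) n (g h : nat -> C) :
  (rank (val y) + n.+1)%N = r ->
  \sum_(w | (y < w)%O) g (rank w - rank y)%N * h (rank (val w)) =
  g (nsel S (rank (val y)) n).+1 * h r +
  \sum_(j < n | S ((rank (val y)).+1 + j)%N) g (nsel S (rank (val y)) j.+1) *
    h ((rank (val y)).+1 + j)%N * level_sum (rank (val y)) j.
Proof.
set k := rank (val y) => kn.
rewrite (eq_bigr (fun w : Q => g (sel_rank (rank (val w)) - sel_rank k)%N * h (rank (val w)))); last first.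
  by move=> w _; rewrite !(rank_rank_sel gradedP ELlam S_sub).
rewrite (sum_above_rank_sel gradedP ELlam unif
  (fun m => g (sel_rank m - sel_rank k)%N * h m) kn).
rewrite -/k (sel_rank_sub_top kn); congr (_ + _); apply: eq_bigr => j _.
by rewrite sel_rank_sub //; have := ltn_ord j; lia.
Qed.

Definition chow_value k : C := if k == r then 1 else headk 1 k (r - k).-1.

Lemma ev_chow (y : Q) : ev (chow_above R y) = chow_value (rank (val y)).
Proof.
move: y; apply: (up_ind (T := Q)) => y IH.
rewrite chow_above_qsum evD ev1 ev_sum.
have [->|/rank_lt_top[n kn]] := eqVneq y \top%O.
  by rewrite /chow_value eqxx big_pred0 ?addr0 // => w; rewrite lt1x.
rewrite (eq_bigr (fun w : Q => qsum x (rank w - rank y) * chow_value (rank (val w)))); last first.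
  by move=> w yw; rewrite evM ev_qsum IH.
rewrite (sum_weighted _ _ kn).
have nr : (rank (val y) == r) = false by apply/eqP; lia.
have nE : (r - rank (val y)).-1 = n by lia.
rewrite /chow_value nr eqxx mulr1 nE headsE (level_sum_top gradedP ELlam unif _ kn).
rewrite qsum_S_gsum addrA mulr1 [1 + x - 1]addrC addKr; congr (_ + _).
apply: eq_bigr => j _; have jn := ltn_ord j; congr (_ * _ * _).
have -> : ((rank (val y)).+1 + j == r)%N = false by apply/eqP; lia.
by congr heads; lia.
Qed.

Section PositiveRank.
Hypothesis r0 : (0 < r)%N.
Local Notation runx al := (chow_run (ell lam) (om lam) (ds lam) S (1 + x) x (consts al (1 + x)) 0 r.-1).

Let bot_rank : (rank (val (\bot%O : Q)) + r.-1.+1)%N = r.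
Proof. by rewrite rank0 add0n prednK. Qed.

Lemma ev_chow_bot : ev (chow R Q) = lsum (ell lam) (om lam) 0 (runx 1).1.
Proof.
have z0 : (0%N == r) = false by apply/eqP; lia.
by rewrite /chow ev_chow /chow_value rank0 subn0 z0.
Qed.

Lemma ev_aug_chow : ev (aug_chow R Q) = lsum (ell lam) (om lam) 0 (runx 1).2.
Proof.
rewrite /aug_chow ev_sum (bigD1 (\bot%O : Q)) //= rank0 expr0 mul1r ev_chow_bot.
rewrite (eq_bigl (fun w : Q => \bot < w)%O); last by move=> w; rewrite lt0x.
rewrite (eq_bigr (fun w : Q => x ^+ (rank w - rank (\bot%O : Q)) * chow_value (rank (val w)))); last first.
  by move=> w _; rewrite evM evXn evX ev_chow rank0 subn0.
rewrite (sum_weighted (fun m => x ^+ m) _ bot_rank).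
rewrite lsum_run2 -/(headk 1 0 r.-1) [in RHS]/heads -addrA; congr (_ + _).
rewrite [rank (val _)]rank0 /chow_value eqxx.
rewrite (level_sum_top gradedP ELlam unif C (k := 0)) ?add0n ?prednK //.
rewrite [1 + x - 1]addrC addKr mulr1 exprS mulr1; congr (_ + _).
apply: eq_bigr => j _; have jn := ltn_ord j; congr (_ * _ * _).
have -> : (1 + j == r)%N = false by apply/eqP; lia.
by congr heads; lia.
Qed.

(** Up to the factor 1 + x, the upward recursion with value 1 at the top and
    no constant term elsewhere; below the top it is x times the total of a
    for the transfer started from a = 0. *)
Definition dual_value k : C := if k == r then 1 + x else x * headk 0 k (r - k).-1.

Lemma dual_value_rec (y : Q) : dual_value (rank (val y)) =
  (1 + x) * (y == \top%O)%:R +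
  \sum_(w | (y < w)%O) qsum x (rank w - rank y) * dual_value (rank (val w)).
Proof.
have [->|yt] := eqVneq y \top%O.
  by rewrite /dual_value eqxx mulr1 big_pred0 ?addr0 // => w; rewrite lt1x.
have [n kn] := rank_lt_top yt.
rewrite mulr0 add0r (sum_weighted _ _ kn).
have nr : (rank (val y) == r) = false by apply/eqP; lia.
have nE : (r - rank (val y)).-1 = n by lia.
rewrite /dual_value nr eqxx nE headsE (level_sum_top gradedP ELlam unif _ kn).
rewrite qsum_S_gsum mulr1 add0r subr0 mulrDr; congr (_ + _); first by ring.
rewrite mulr_sumr.
apply: eq_bigr => j _; have jn := ltn_ord j.
have -> : ((rank (val y)).+1 + j == r)%N = false by apply/eqP; lia.
have -> : (r - ((rank (val y)).+1 + j)).-1 = (n - j.+1)%N by lia.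
by ring.
Qed.

Lemma rank_sel_graded : graded Q.
Proof.
exists (fun y : Q => sel_rank (rank (val y))); split.
  by rewrite /= rank0 /sel_rank.
exact: (covers_rank_sel gradedP ELlam S_sub).
Qed.

(** By [transpose_solution] the left-hand side is the sum of the solution of
    the upward recursion; that sum and the total of b differ by the
    geometric identity (x - 1)(x + ... + x^(c-1)) = x^c - x. *)
Lemma ev_chow_dual :
  (1 + x) * ev (chow R Q^d) = lsum (ell lam) (om lam) 0 (runx 0).2.
Proof.
have := transpose_solution (T := Q) (k := fun s t => qsum x (rank t - rank s))
  (c := 1 + x) (f := fun t => ev (chow_above R (t : Q^d)))
  (g := fun y => dual_value (rank (val y))).
move=> /(_ _ dual_value_rec) tr; rewrite /chow [LHS]tr.
  rewrite (bigD1 (\bot%O : Q)) //=.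
  rewrite (eq_bigl (fun w : Q => \bot < w)%O); last by move=> w; rewrite lt0x.
  rewrite (eq_bigr (fun w : Q => 1 * dual_value (rank (val w)))); last first.
    by move=> w _; rewrite mul1r.
  rewrite (sum_weighted (fun=> 1) _ bot_rank) [rank (val _)]rank0.
  rewrite lsum_run2 -/(headk 0 0 r.-1).
  rewrite (level_sum_top gradedP ELlam unif C (k := 0)) ?add0n ?prednK //.
  have z0 : (0%N == r) = false by apply/eqP; lia.
  rewrite {1 2}/dual_value z0 eqxx subn0.
  have e := headsE (ell lam) (om lam) (ds lam) S x 0 (1 + x) 0 r.-1.
  rewrite (level_sum_top gradedP ELlam unif C (k := 0)) ?add0n ?prednK // in e.
  set A := headk 0 0 r.-1 in e *.
  set B := \sum_(j < _ | _) _ in e.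
  set D := (X in _ = _ + X).
  have -> : \sum_(j < r.-1 | S (1 + j)%N) 1 * dual_value (1 + j)%N * level_sum 0 j
     = D - (x - 1) * B.
    rewrite /D /B mulr_sumr -sumrB; apply: eq_bigr => j Sj.
    have jn := ltn_ord j; rewrite /dual_value.
    have -> : (1 + j == r)%N = false by apply/eqP; lia.
    have -> : (r - (1 + j)).-1 = (r.-1 - j.+1)%N by lia.
    have c0 : (0 < nsel S 0 j.+1)%N by apply: nsel_gt0.
    have q : (x - 1) * qsum x (nsel S 0 j.+1) = x ^+ nsel S 0 j.+1 - x.
      by rewrite -(prednK c0) qsum_S_gsum mulrCA -subrX1 mulrBr mulr1 exprS.
    rewrite !mulrA q; ring.
  have g : (x - 1) * gsum x (nsel S 0 r.-1) = x ^+ nsel S 0 r.-1 - 1.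
    by rewrite -subrX1.
  have : (x - 1) * A = (1 + x) * (x ^+ nsel S 0 r.-1 - 1) + (x - 1) * B.
    by rewrite e -g; ring.
  move: (x ^+ _) => X eA; rewrite mul1r.
  have -> : (x - 1) * B = (x - 1) * A - (1 + x) * (X - 1) by rewrite eA; ring.
  by ring.
move=> t; rewrite chow_above_qsum evD ev1 ev_sum; congr (_ + _).
apply: eq_bigr => s lt; rewrite evM ev_qsum !(rank_dual rank_sel_graded).
have ar N a b : (a <= N -> b <= N -> N - a - (N - b) = b - a)%N by lia.
by congr (qsum _ _ * _); apply: ar; exact: rank_le_top.
Qed.

Definition h_value k : C :=
  if k == r then 1 else hheads (ell lam) (om lam) (ds lam) S x k (r - k).-1.

Lemma chain_sum_value (y : Q) : chain_sum x (1 - x) y = h_value (rank (val y)).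
Proof.
move: y; apply: (up_ind (T := Q)) => y IH; rewrite chain_sum_rec.
have [->|yt] := eqVneq y \top%O.
  by rewrite /h_value eqxx subnn expr0 big_pred0 ?addr0 // => w; rewrite lt1x.
have [n kn] := rank_lt_top yt.
rewrite (eq_bigr (fun w : Q => (x * (1 - x) ^+ (rank w - rank y).-1) * h_value (rank (val w)))); last first.
  by move=> w yw; rewrite IH.
rewrite (sum_weighted (fun m => x * (1 - x) ^+ m.-1) _ kn).
have nr : (rank (val y) == r) = false by apply/eqP; lia.
have nE : (r - rank (val y)).-1 = n by lia.
rewrite !(rank_rank_sel gradedP ELlam S_sub) (sel_rank_sub_top kn) exprS.
rewrite /h_value nr eqxx nE hheadsE (level_sum_top gradedP ELlam unif _ kn) addrA.
congr (_ + _); first by move: (_ ^+ _) => X /=; ring.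
apply: eq_bigr => j _; have jn := ltn_ord j.
have -> : ((rank (val y)).+1 + j == r)%N = false by apply/eqP; lia.
have -> : (r - ((rank (val y)).+1 + j)).-1 = (n - j.+1)%N by lia.
by rewrite [x * _]mulrC.
Qed.

Lemma ev_h_polynomial : ev (h_polynomial R (order_complex Q)) =
  lsum (ell lam) (om lam) 0 (h_run (ell lam) (om lam) (ds lam) S x 0 r.-1).
Proof.
have z0 : (0%N == r) = false by apply/eqP; lia.
transitivity (h_value 0); last by rewrite /h_value z0 subn0.
rewrite -[X in h_value X](rank0 (T := P)) -(chain_sum_value (\bot%O : Q)).
rewrite h_polynomialE /chain_sum ev_sum; apply: eq_bigr => A _.
by rewrite evM !evXn evB evX ev1.
Qed.

End PositiveRank.
End Evaluation.

(** * The slit plane and the theorem *)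

Section SlitPlane.
Context {C : numClosedFieldType}.
Implicit Types x z : C.

(** If [s + t * z = 0] with [t] nonzero, then [z] equals [- s / t]. *)
Lemma salient_slit z : ~~ (z <= 0) -> salient z.
Proof.
move=> z0 s t s0 t0 e; have [t00|tn0] := eqVneq t 0.
  by split=> //; rewrite t00 mul0r addr0 in e.
case/negP: z0; have -> : z = - (s / t).
  apply: (mulfI tn0); rewrite mulrN mulrCA divff // mulr1.
  by apply/eqP; rewrite -addr_eq0 addrC e.
by rewrite oppr_le0 divr_ge0.
Qed.

Lemma slit_neqN1 x : ~~ (x <= 0) -> 1 + x != 0.
Proof.
by apply: contraNneq => /eqP; rewrite addrC addr_eq0 => /eqP ->; rewrite oppr_le0 ler01.
Qed.

(** If w = x / (1 + x)^2 is real then x and its conjugate solve the same real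
    quadratic equation.  If x is not real their product is therefore 1,
    whence w |1 + x|^2 = 1 and w > 0.  If x is real it has the sign of w. *)
Lemma koebe_slit x : ~~ (x <= 0) -> ~~ (x / (1 + x) ^+ 2 <= 0).
Proof.
move=> x0; have x1 := slit_neqN1 x0; apply: contra x0.
set w := x / _ => w0; have xE : x = w * (1 + x) ^+ 2 by rewrite mulfVK // expf_neq0.
have wr : w^* = w by rewrite conj_Creal // ler0_real.
suff xr : x^* = x.
  rewrite xE mulr_le0_ge0 // real_exprn_even_ge0 // rpredD ?rpred1 //.
  exact/CrealP.
apply/eqP/negPn/negP => xx; have d0 : x - x^* != 0 by rewrite subr_eq0 eq_sym.
have cE : x^* = w * (1 + x^*) ^+ 2.
  by rewrite {1}xE rmorphM rmorphXn rmorphD rmorph1 /= wr.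
have e : w * (2 + x + x^*) = 1.
  apply: (mulfI d0); rewrite mulr1.
  transitivity (w * (1 + x) ^+ 2 - w * (1 + x^*) ^+ 2); first by ring.
  by rewrite -xE -cE.
have wn0 : w != 0 by apply: contra_eq_neq e => ->; rewrite mul0r eq_sym oner_neq0.
have e1 : x * x^* = 1.
  have : x^* * (1 + x) ^+ 2 = x * (1 + x^*) ^+ 2.
    by apply: (mulfI wn0); rewrite mulrCA -xE mulrCA -cE mulrC.
  move/eqP; rewrite -subr_eq0 => /eqP h.
  have : (x - x^*) * (x * x^* - 1) = 0 by rewrite -h; ring.
  by move/eqP; rewrite mulf_eq0 (negPf d0) subr_eq0 => /eqP.
have : w * ((1 + x) * (1 + x)^*) = 1.
  rewrite -[RHS]e rmorphD rmorph1 /=; congr (w * _).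
  transitivity (1 + x + x^* + x * x^*); [by ring | by rewrite e1; ring].
move=> e2; have : w * ((1 + x) * (1 + x)^*) <= 0.
  by rewrite mulr_le0_ge0 // mul_conjC_ge0.
by rewrite e2 ler10.
Qed.

Lemma upper_slit x : 0 < 'Im x -> ~~ (x <= 0).
Proof.
by apply: contraTN => /ler0_real/Creal_ImP ->; rewrite ltxx.
Qed.

End SlitPlane.

Section RealPolys.
Context {R : realType}.
Local Notation rc := (real_complex R).
Implicit Types p : {poly R}.

Lemma nonpos_real_roots_ev p :
  (forall x : R[i], ~~ (x <= 0) -> ev x p != 0) -> nonpos_real_roots p.
Proof.
move=> h z; rewrite rootE => pz; have z0 : z <= 0.
  by apply: contraLR pz; exact: h.
have /complex_realP[a za] : z \is Num.real by exact: ler0_real.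
by exists a => //; move: z0; rewrite za lecR.
Qed.

Lemma lead_coef_gt0 p : p != 0 -> (forall i, 0 <= p`_i) -> 0 < lead_coef p.
Proof. by move=> p0 pp; rewrite lt_def lead_coef_eq0 p0 /lead_coef pp. Qed.

End RealPolys.

Section TrivialPoset.
Context (R : realType) {d : Order.disp_t} {T : finTBPOrderType d}.
Hypothesis bot_top : (\bot : T)%O = \top%O.

Lemma trivial_top (s : T) : s = \top%O.
Proof. by apply/eqP; rewrite eq_le lex1 -bot_top le0x. Qed.

Lemma trivial_chow : chow R T = 1.
Proof. by rewrite /chow chow_aboveE bot_top eqxx. Qed.

Lemma trivial_aug_chow : aug_chow R T = 1.
Proof.
rewrite /aug_chow (big_pred1 \top%O) => [|s]; last by rewrite /= (trivial_top s) eqxx.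
by rewrite -bot_top rank0 expr0 mul1r; exact: trivial_chow.
Qed.

Lemma trivial_h_polynomial : h_polynomial R (order_complex T) = 1.
Proof.
rewrite h_polynomialE chain_sum_rec big_pred0 => [|w]; last by rewrite (trivial_top w) bot_top ltxx.
by rewrite bot_top subnn expr0 addr0.
Qed.

End TrivialPoset.

Theorem theorem1p6 (R : realType) (d : Order.disp_t) (P : finTBPOrderType d)
    (gradedP : graded P) (umelP : UMEL_shellable P)
    (S : pred nat)
    (S_sub : forall i : nat, i \in S -> (1 <= i < rank (\top%O : P))%N) :
  [/\ nonpos_real_roots (chow R (rank_sel P S)) /\
      nonpos_real_roots (chow R (rank_sel P S)^d),
      nonpos_real_roots (aug_chow R (rank_sel P S)),
      roots_interlace (chow R (rank_sel P S)) (aug_chow R (rank_sel P S)) &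
      nonpos_real_roots (h_polynomial R (order_complex (rank_sel P S)))].
Proof.
have root1 : nonpos_real_roots (1 : {poly R}).
  by apply: nonpos_real_roots_ev => x _; rewrite ev1 oner_neq0.
have [r0|r0] := posnP (rank (\top%O : P)).
  (* In rank 0 all four polynomials equal 1. *)
  have bt : (\bot : rank_sel P S)%O = \top%O.
    apply: val_inj => /=; apply/esym/eqP; rewrite -rank_bot_eq; exact/eqP.
  rewrite trivial_chow // (@trivial_chow R _ (rank_sel P S)^d) //.
  rewrite trivial_aug_chow // trivial_h_polynomial //.
  by split=> //; apply: Or33; rewrite size_poly1.
have [dL [L [lam [ELlam unif mono]]]] := umelP.
have dsm k i j : (k < 0 + (rank (\top%O : P)).-1)%N -> (i <= j < ell lam k)%N ->
    (ds lam k i <= ds lam k j)%N.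
  by move=> _; exact: (ds_mono mono).
have nz : lsum (ell lam) (om lam) 0 (asc (ell lam) (om lam) (ds lam) 0
    (rank (\top%O : P)).-1) != 0 :> R[i].
  by rewrite (level_sum_top gradedP ELlam unif) ?oner_neq0 // add0n prednK.
have chowP : nonpos_real_roots (chow R (rank_sel P S)).
  apply: nonpos_real_roots_ev => x x0.
  rewrite (ev_chow_bot gradedP ELlam unif S_sub x r0).
  have [h _] := run_neq0 S dsm nz (slit_neqN1 x0) (salient_slit (koebe_slit x0)) (or_intror (erefl (1 : R[i]))).
  exact: h.
have augP : nonpos_real_roots (aug_chow R (rank_sel P S)).
  apply: nonpos_real_roots_ev => x x0.
  rewrite (ev_aug_chow gradedP ELlam unif S_sub x r0).
  by have [_ h] := run_neq0 S dsm nz (slit_neqN1 x0) (salient_slit (koebe_slit x0)) (or_intror (erefl (1 : R[i]))).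
have neq0 p : nonpos_real_roots p -> p != 0 :> {poly R}.
  by case/real_roots_of => s [].
split=> //.
(* The dual poset corresponds to the initial pair with a = 0. *)
- split=> //; apply: nonpos_real_roots_ev => x x0.
  have [_] := run_neq0 S dsm nz (slit_neqN1 x0) (salient_slit (koebe_slit x0)) (or_introl (erefl (0 : R[i]))).
  rewrite -(ev_chow_dual gradedP ELlam unif S_sub x r0).
  by rewrite mulf_eq0 => /norP[].
- apply: Or31; apply: interlaces_upper => //.
  + by apply: lead_coef_gt0; [exact: neq0|move=> i; exact: chow_above_ge0].
  + by apply: lead_coef_gt0; [exact: neq0|exact: aug_chow_ge0].
  + move=> x xi; have x0 := upper_slit xi.
    rewrite -/(ev x _) -/(ev x _) (ev_chow_bot gradedP ELlam unif S_sub x r0).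
    rewrite (ev_aug_chow gradedP ELlam unif S_sub x r0).
    have [s [t [s0 t0 ->]]] := run_between (om lam) S dsm (slit_neqN1 x0) (salient_slit (koebe_slit x0)).
    rewrite raddfD /= (ImMl (ger0_real s0)) (ImMl (ger0_real t0)).
    rewrite addr_ge0 // mulr_ge0 //.
      by rewrite raddfD /= (Creal_ImP _ _) ?rpred1 // add0r ltW.
    rewrite Im_div divr_ge0 ?exprn_ge0 // !raddfD /=.
    rewrite (Creal_ReP 1 _) ?rpred1 // (Creal_ImP 1 _) ?rpred1 // add0r mulrDl mul1r.
    by rewrite [X in 0 <= X]addrK ltW.
- apply: nonpos_real_roots_ev => x x0.
  rewrite (ev_h_polynomial gradedP ELlam unif S_sub x r0).
  exact: (hrun_neq0 S dsm nz (salient_slit x0)).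
Qed.
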